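(* Let $K$ be a field, $\mathsf{M}$ a matroid on $[n]$, $E=K\langle e_1,\dots,e_n\rangle$ and $J$ the Orlik–Solomon ideal of $\mathsf{M}$. (i) If $\mathsf{M}=U_{m,n-f}\oplus U_{f,f}$ for some $f\geq0$, then $\beta^E_i(J)=\binom{n-f-1+i}{m+i}\binom{m+i-1}{i}$ for all $i\ge 0$. (ii) If $\mathsf{M}=U_{1,n_1}\oplus\dots\oplus U_{1,n_k}\oplus U_{f,f}$ for some $k,f\geq0$ with $n=f+\sum_{i=1}^kn_i$, then $\beta^E_i(J)=\binom{n-f-k+i}{i+1}$ for all $i\ge0$.
   Context: A matroid on $[n]$ is a nonempty family of subsets of $[n]$ (independent sets) containing $\emptyset$, closed under subsets, satisfying the exchange axiom; other subsets are dependent. The uniform matroid $U_{a,b}$ on a $b$-element set has as independent sets all subsets of cardinality at most $a$. The direct sum of matroids on disjoint ground sets (here a partition of $[n]$) has as independent sets the unions of independent sets of the summands. $E$ is the standard graded exterior algebra; for $S=\{i_0<\dots<i_m\}$, $e_S=e_{i_0}\wedge\dots\wedge e_{i_m}$ and $\partial e_S=\sum_{j=0}^m(-1)^je_{S\setminus\{i_j\}}$; the Orlik–Solomon ideal is $J=(\partial e_S:S\text{ dependent})$. $\beta^E_i(J)=\sum_j\dim_K\operatorname{Tor}^E_i(K,J)_j$ is the $i$-th total Betti number.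
   Formalization: In (ii) every n_i is assumed at least 1 (an empty summand U_{1,0} makes the formula false); in (i) the case m=0, n=f is excluded, where J=0 but the formula gives 1 at i=0 under the convention C(-1,0)=1 that the case m=0<n-f forces. *)

(* Defs.v *)
From HB Require Import structures.
From mathcomp Require Import all_boot all_order all_algebra.

Set Implicit Arguments.
Unset Strict Implicit.
Unset Printing Implicit Defensive.

Import Order.TTheory GRing.Theory Num.Theory.
Local Open Scope ring_scope.

(* [x : ext K n] is the element \sum_S x S *: e_S of K<e_1, ..., e_n>;
   the variables are indexed by 'I_n = {0, ..., n-1}. *)
Definition ext (K : fieldType) (n : nat) : Type := {ffun {set 'I_n} -> K^o}.

(* Only the linear structure is inherited: the product of [ext K n] is the
   exterior product below, not the pointwise product of finite functions. *)
HB.instance Definition _ (K : fieldType) (n : nat) := Choice.on (ext K n).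
HB.instance Definition _ (K : fieldType) (n : nat) := GRing.Lmodule.on (ext K n).

(* Number of transpositions needed to sort the concatenation of the increasing
   enumerations of A and B: for A, B disjoint,
   e_A * e_B = (-1) ^+ shuffle_inv A B *: e_(A :|: B). *)
Definition shuffle_inv (n : nat) (A B : {set 'I_n}) : nat :=
  (\sum_(a in A) \sum_(b in B) (b < a))%N.

Section ExtRing.
Variables (K : fieldType) (n : nat).
Implicit Types (x y z : ext K n) (A B C S : {set 'I_n}).

Definition extb S : ext K n := [ffun T : {set 'I_n} => (T == S)%:R].

Definition ext_mul x y : ext K n :=
  [ffun S : {set 'I_n} => \sum_(A : {set 'I_n} | A \subset S)
    (-1) ^+ shuffle_inv A (S :\: A) * (x A : K) * (y (S :\: A) : K)].

Lemma shuffle_inv0l B : shuffle_inv set0 B = 0%N.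
Proof. by rewrite /shuffle_inv big_set0. Qed.

Lemma shuffle_inv0r A : shuffle_inv A set0 = 0%N.
Proof. by rewrite /shuffle_inv big1 // => a _; rewrite big_set0. Qed.

Lemma shuffle_invUl A B C : [disjoint A & B] ->
  shuffle_inv (A :|: B) C = (shuffle_inv A C + shuffle_inv B C)%N.
Proof.
move=> dAB; rewrite /shuffle_inv (big_setID A) /=.
by rewrite setUK setDUl setDv set0U (setDidPl _) // disjoint_sym.
Qed.

Lemma shuffle_invUr A B C : [disjoint B & C] ->
  shuffle_inv A (B :|: C) = (shuffle_inv A B + shuffle_inv A C)%N.
Proof.
move=> dBC; rewrite /shuffle_inv -big_split /=; apply: eq_bigr => a _.
rewrite (big_setID B) /=.
by rewrite setUK setDUl setDv set0U (setDidPl _) // disjoint_sym.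
Qed.

Lemma ext_mulA : associative ext_mul.
Proof.
move=> x y z; apply/ffunP => S; rewrite !ffunE; apply/esym.
under eq_bigr => A _ do rewrite ffunE mulr_sumr mulr_suml.
rewrite (exchange_big_dep (fun B => B \subset S)) /=; last first.
  by move=> A B AS BA; apply: subset_trans AS.
apply: eq_bigr => B BS; rewrite ffunE mulr_sumr.
rewrite (reindex_onto (fun C => B :|: C) (fun A => A :\: B)) /=; last first.
  by move=> A /andP[_ BA]; rewrite -{1}(setIidPr BA) setID.
have E C : (((B :|: C) \subset S) && (B \subset B :|: C)) &&
   ((B :|: C) :\: B == C) = (C \subset S :\: B).
  rewrite subsetUl andbT subUset BS /= setDUl setDv set0U subsetD.
  by congr (_ && _); apply/eqP/idP => [/setDidPl|/setDidPl].
apply: eq_big => // C; rewrite E subsetD => /andP[CS dCB].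
have dBC : [disjoint B & C] by rewrite disjoint_sym.
have -> : (B :|: C) :\: B = C by rewrite setDUl setDv set0U; apply/setDidPl.
rewrite setDDl; set D := S :\: (B :|: C).
have dD : S :\: B = C :|: D.
  apply/setP => i; rewrite !inE; case Ci: (i \in C) => /=.
    by rewrite (subsetP CS) // andbT (disjointFr dCB).
  by rewrite orbF.
have dCD : [disjoint C & D].
  rewrite -setI_eq0; apply/eqP/setP => i; rewrite !inE.
  by case: (i \in C); rewrite ?orbT.
rewrite dD shuffle_invUl // shuffle_invUr // !exprD.
have mulEq (s t u a b c : K) :
    s * t * (u * a * b) * c = u * s * a * (t * b * c).
  by rewrite !mulrA ![_ * u]mulrC !mulrA [_ * t * a]mulrAC.
exact: mulEq.
Qed.

Lemma ext_mul1l : left_id (extb set0) ext_mul.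
Proof.
move=> x; apply/ffunP => S; rewrite !ffunE (bigD1 set0) ?sub0set //=.
rewrite big1 => [|A /andP[_ /negPf nA]]; last by rewrite ffunE nA mulr0 mul0r.
by rewrite addr0 ffunE eqxx shuffle_inv0l setD0 expr0 !mul1r.
Qed.

Lemma ext_mul1r : right_id (extb set0) ext_mul.
Proof.
move=> x; apply/ffunP => S; rewrite !ffunE (bigD1 S) //=.
rewrite big1 => [|A /andP[AS nA]].
  by rewrite addr0 ffunE setDv eqxx shuffle_inv0r expr0 mulr1 mul1r.
by rewrite ffunE setD_eq0 [S \subset A]negbTE ?mulr0 //; rewrite eqEsubset AS /= in nA.
Qed.

Lemma ext_mulDl : left_distributive ext_mul +%R.
Proof.
move=> x y z; apply/ffunP => S; rewrite !ffunE -big_split /=.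
by apply: eq_bigr => A _; rewrite ffunE mulrDr mulrDl.
Qed.

Lemma ext_mulDr : right_distributive ext_mul +%R.
Proof.
move=> x y z; apply/ffunP => S; rewrite !ffunE -big_split /=.
by apply: eq_bigr => A _; rewrite ffunE mulrDr.
Qed.

Lemma ext_1neq0 : extb set0 != 0.
Proof.
by apply/eqP => /ffunP/(_ set0)/eqP; rewrite !ffunE eqxx oner_eq0.
Qed.

End ExtRing.

HB.instance Definition _ (K : fieldType) (n : nat) :=
  GRing.Zmodule_isNzRing.Build (ext K n) (@ext_mulA K n) (@ext_mul1l K n)
    (@ext_mul1r K n) (@ext_mulDl K n) (@ext_mulDr K n) (@ext_1neq0 K n).

Lemma ext_scaleAl (K : fieldType) (n : nat) (a : K) (x y : ext K n) :
  a *: (x * y) = (a *: x) * y.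
Proof.
apply/ffunP => S; rewrite !ffunE scaler_sumr; apply: eq_bigr => A _.
by rewrite ffunE /GRing.scale /= !mulrA [a * _]mulrC.
Qed.

HB.instance Definition _ (K : fieldType) (n : nat) :=
  GRing.Lmodule_isLalgebra.Build K (ext K n) (@ext_scaleAl K n).

Lemma ext_scaleAr (K : fieldType) (n : nat) (a : K) (x y : ext K n) :
  a *: (x * y) = x * (a *: y).
Proof.
apply/ffunP => S; rewrite !ffunE scaler_sumr; apply: eq_bigr => A _.
by rewrite ffunE /GRing.scale /= mulrCA.
Qed.

HB.instance Definition _ (K : fieldType) (n : nat) :=
  GRing.Lalgebra_isAlgebra.Build K (ext K n) (@ext_scaleAr K n).

Lemma extE (K : fieldType) (n : nat) (x y : ext K n) : x * y = ext_mul x y.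
Proof. by []. Qed.

Section ExtBasis.
Variables (K : fieldType) (n : nat).
Implicit Types (A B S : {set 'I_n}) (i j : 'I_n).

Lemma extb_mul A B : extb K A * extb K B =
  if [disjoint A & B] then (-1) ^+ shuffle_inv A B *: extb K (A :|: B) else 0.
Proof.
apply/ffunP => S; rewrite extE [LHS]ffunE.
have [AS|nAS] := boolP (A \subset S); last first.
  rewrite big1 => [|C CS]; last first.
    by rewrite ffunE; case: eqP nAS CS => [-> /negP //|]; rewrite mulr0 mul0r.
  case: ifP => _; rewrite !ffunE //.
  by case: eqP nAS => [->|]; rewrite ?subsetUl // scaler0.
rewrite (bigD1 A) //= big1 ?addr0 => [|C /andP[_ /negPf nC]]; last first.
  by rewrite ffunE nC mulr0 mul0r.
rewrite !ffunE eqxx mulr1; case: ifP => [dAB|ndAB]; last first.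
  rewrite ffunE; case: eqP => [E|]; rewrite ?mulr0 //.
  by rewrite -E -setI_eq0 setIDA setDIl setDv set0I eqxx in ndAB.
rewrite !ffunE; have -> : (S :\: A == B) = (S == A :|: B).
  apply/eqP/eqP => [<-|->].
    by rewrite -{1}(setIidPr AS) setID.
  by rewrite setDUl setDv set0U; apply/setDidPl; rewrite disjoint_sym.
by case: eqP => [->|]; rewrite ?mulr0 ?scaler0 // setDUl setDv set0U
  (setDidPl _) // disjoint_sym.
Qed.

Lemma extb_sq i : extb K [set i] * extb K [set i] = 0.
Proof. by rewrite extb_mul disjoints1 inE eqxx. Qed.

Lemma extb_anticomm i j :
  extb K [set i] * extb K [set j] = - (extb K [set j] * extb K [set i]).
Proof.
rewrite !extb_mul !disjoints1 !inE [j == i]eq_sym.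
have [->|ij] := eqVneq i j; first by rewrite oppr0.
rewrite setUC -scaleNr /shuffle_inv !big_set1; congr (_ *: _).
by case: ltngtP ij => [||/val_inj ->]; rewrite ?eqxx // expr0 expr1 ?opprK.
Qed.

(* [enum S] lists S increasingly, so this is e_S = e_i0 /\ ... /\ e_im. *)
Lemma extb_prod S : extb K S = \prod_(i <- enum S) extb K [set i].
Proof.
have sS : sorted (relpre val ltn) (enum S).
  rewrite {1}/enum_mem; apply: sorted_filter; first by move=> ? ? ?; apply: ltn_trans.
  by rewrite -sorted_map -enumT val_enum_ord iota_ltn_sorted.
rewrite -[S in LHS]set_enum; elim: (enum S) sS => [|i s IH] /=.
  by rewrite big_nil set_nil.
rewrite (path_sortedE (fun _ _ _ => @ltn_trans _ _ _)) => /andP[/allP lt_i sorted_s].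
rewrite big_cons -(IH sorted_s) extb_mul disjoints1 inE.
case: ifP => [_|/negbFE /lt_i]; last by rewrite /= ltnn.
rewrite set_cons /shuffle_inv big_set1 big1 ?scale1r // => j.
by rewrite inE => /lt_i /= lt_ij; rewrite ltnNge ltnW.
Qed.

End ExtBasis.

Definition homogeneous (K : fieldType) (n : nat) (d : int) (x : ext K n) : Prop :=
  forall S : {set 'I_n}, x S != 0 -> #|S|%:Z = d.

(* The augmentation E -> K = E / (e_1, ..., e_n). *)
Definition ext_eps (K : fieldType) (n : nat) (x : ext K n) : K := x set0.

Definition ideal_gen (K : fieldType) (n : nat) (G : ext K n -> Prop)
    (x : ext K n) : Prop :=
  exists (r : nat) (a g b : 'I_r -> ext K n),
    (forall i, G (g i)) /\ x = \sum_(i < r) a i * g i * b i.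

Record matroid (n : nat) := Matroid {
  indep : {set {set 'I_n}};
  indep0 : set0 \in indep;
  indep_sub : forall S T : {set 'I_n}, T \in indep -> S \subset T -> S \in indep;
  indep_exchange : forall S T : {set 'I_n}, S \in indep -> T \in indep ->
    (#|S| < #|T|)%N -> exists2 x, x \in T :\: S & x |: S \in indep }.

(* Independent sets of U_{a, #|A|} on the ground set A. *)
Definition uniform (n a : nat) (A : {set 'I_n}) : {set {set 'I_n}} :=
  [set S : {set 'I_n} | (S \subset A) && (#|S| <= a)%N].

(* Independent sets of a direct sum, for disjoint ground sets; its neutral
   element [set set0] is the matroid on the empty ground set. *)
Definition direct_sum (n : nat) (I1 I2 : {set {set 'I_n}}) : {set {set 'I_n}} :=
  [set S1 :|: S2 | S1 in I1, S2 in I2].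

(* The position of j in the increasing enumeration of S is the number of
   elements of S below j. *)
Definition boundary (K : fieldType) (n : nat) (S : {set 'I_n}) : ext K n :=
  \sum_(j in S) (-1) ^+ #|[set i in S | (i < j)%N]| *: extb K (S :\ j).

Definition orlik_solomon (K : fieldType) (n : nat) (M : matroid n) :
    ext K n -> Prop :=
  ideal_gen (fun x => exists2 S : {set 'I_n}, S \notin indep M & x = boundary K S).

(* Data of a complex ... -> F_1 -> F_0 -> E of finitely generated graded free
   left E-modules.  F_i = E^(gf_rank i) consists of row vectors, its k-th basis
   vector has degree gf_deg i k, and the maps are multiplications on the right
   by matrices over E, hence are left E-linear. *)
Record graded_free (K : fieldType) (n : nat) := GradedFree {
  gf_rank : nat -> nat;
  gf_deg : forall i, 'I_(gf_rank i) -> int;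
  gf_aug : 'cV[ext K n]_(gf_rank 0);
  gf_dif : forall i, 'M[ext K n]_(gf_rank i.+1, gf_rank i) }.

Arguments gf_rank {K n}.
Arguments gf_deg {K n}.
Arguments gf_aug {K n}.
Arguments gf_dif {K n}.

(* The complex is homogeneous of degree 0 and ... -> F_1 -> F_0 -> J -> 0 is
   exact. *)
Record resolves (K : fieldType) (n : nat) (F : graded_free K n)
    (J : ext K n -> Prop) : Prop := Resolves {
  aug_homogeneous : forall k, homogeneous (gf_deg F 0 k) (gf_aug F k 0);
  dif_homogeneous : forall i k l,
    homogeneous (gf_deg F i.+1 k - gf_deg F i l) (gf_dif F i k l);
  aug_exact : forall x, J x <->
    exists v : 'rV[ext K n]_(gf_rank F 0), v *m gf_aug F = x%:M;
  dif0_exact : forall v : 'rV[ext K n]_(gf_rank F 0),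
    v *m gf_aug F = 0 <-> exists w, v = w *m gf_dif F 0;
  dif_exact : forall i (v : 'rV[ext K n]_(gf_rank F i.+1)),
    v *m gf_dif F i = 0 <-> exists w, v = w *m gf_dif F i.+1 }.

Section Tor.
Variables (K : fieldType) (n : nat) (F : graded_free K n).

(* K (x)_E F_i is K^(gf_rank i), with differential given by the matrix
   [tor_dif i] : K (x)_E F_(i+1) -> K (x)_E F_i. *)
Definition tor_dif i : 'M[K]_(gf_rank F i.+1, gf_rank F i) :=
  map_mx (@ext_eps K n) (gf_dif F i).

(* Row spaces: the degree j parts of K (x)_E F_i, of its cycles and of its
   boundaries. *)
Definition tor_chains i (j : int) : 'M[K]_(gf_rank F i) :=
  diag_mx (\row_k (gf_deg F i k == j)%:R).

Definition tor_cycles i (j : int) : 'M[K]_(gf_rank F i) :=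
  match i return 'M[K]_(gf_rank F i) with
  | 0 => tor_chains 0 j
  | i'.+1 => (tor_chains i'.+1 j :&: kermx (tor_dif i'))%MS
  end.

Definition tor_boundaries i (j : int) : 'M[K]_(gf_rank F i.+1, gf_rank F i) :=
  tor_chains i.+1 j *m tor_dif i.

(* dim_K H_i(K (x)_E F)_j *)
Definition tor_dim i (j : int) : nat :=
  (\rank (tor_cycles i j) - \rank (tor_boundaries i j))%N.

(* K (x)_E F_i is concentrated in the degrees of the basis of F_i. *)
Definition tor_total_dim i : nat :=
  (\sum_(j <- undup (codom (gf_deg F i))) tor_dim i j)%N.

End Tor.

(* Tor_i(K, J) may be computed from any graded free resolution of J. *)
Definition betti_number (K : fieldType) (n : nat) (J : ext K n -> Prop)
    (i b : nat) : Prop :=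
  (exists F : graded_free K n, resolves F J) /\
  (forall F : graded_free K n, resolves F J -> tor_total_dim F i = b).

(* Main.v *)
Require Import Defs.
From HB Require Import structures.
From mathcomp Require Import all_boot all_order all_algebra.

(** In both cases the Orlik-Solomon ideal is the m-th power (m = 1 in case (ii))
    of the ideal generated by the linear forms e_i - e_(r i), where r sends every
    element of a summand U_(m, n - f), resp. U_(1, n_j), to a chosen element of
    that summand and fixes the coloops.  This follows from
    d e_S = +- \prod_(i in S \ s) (e_i - e_s) for s in S.  A linear change of
    variables turns these forms into variables, hence J into the ideal F_m(L)
    spanned by the monomials having at least m indices in a set L.

    F_m(L) has a linear resolution.  Adding a variable a to L adds the generators
    e_a e_W, with W a subset of L of size m - 1, and the colon ideal of each of
    them with respect to the preceding ones is generated by the variables in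
    a and L; so the resolution is an iterated mapping cone over Cartan complexes,
    and its ranks satisfy the Pascal-type recursion of the closed formula.  A
    linear resolution is minimal, and comparing it with an arbitrary graded free
    resolution, by chain maps and homotopies, yields the Tor dimensions. *)

Set Implicit Arguments.
Unset Strict Implicit.
Unset Printing Implicit Defensive.

Import Order.TTheory GRing.Theory Num.Theory.
Local Open Scope ring_scope.

(** * Exactness, mapping cones and homotopies *)

(** Matrices act on row vectors from the right, so [d1] is the incoming map; the equivalence
    includes [d1 *m d0 = 0]. *)
Definition exact_at (R : nzRingType) (m n p : nat)
    (d1 : 'M[R]_(m, n)) (d0 : 'M[R]_(n, p)) : Prop :=
  forall v : 'rV[R]_n, v *m d0 = 0 <-> exists w, v = w *m d1.

Section Exactness.
Variable R : nzRingType.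

Lemma lift_rows (q m n : nat) (V : 'M[R]_(q, n)) (d : 'M[R]_(m, n)) :
  (forall i, exists w, row i V = w *m d) -> exists W, V = W *m d.
Proof.
move=> /fin_all_exists [f Hf]; exists (\matrix_i f i).
by apply/row_matrixP => i; rewrite row_mul rowK Hf.
Qed.

Lemma exact_lift (q m n p : nat) (d1 : 'M[R]_(m, n)) (d0 : 'M[R]_(n, p))
    (V : 'M[R]_(q, n)) :
  exact_at d1 d0 -> V *m d0 = 0 -> exists W, V = W *m d1.
Proof.
move=> ex V0; apply: lift_rows => i; apply/ex.
by rewrite -row_mul V0 row0.
Qed.

Lemma exact_mul0 (m n p : nat) (d1 : 'M[R]_(m, n)) (d0 : 'M[R]_(n, p)) :
  exact_at d1 d0 -> d1 *m d0 = 0.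
Proof.
move=> ex; apply/row_matrixP => i; rewrite row0 row_mul; apply/ex.
by exists (delta_mx 0 i); rewrite rowE.
Qed.

Lemma exact_oppl (m n p : nat) (d1 : 'M[R]_(m, n)) (d0 : 'M[R]_(n, p)) :
  exact_at d1 d0 -> exact_at (- d1) d0.
Proof.
move=> ex v; split=> [/ex [w ->]|[w ->]].
  by exists (- w); rewrite mulNmx mulmxN opprK.
by rewrite mulmxN -mulNmx; apply/ex; exists (- w).
Qed.

Lemma exact_oppr (m n p : nat) (d1 : 'M[R]_(m, n)) (d0 : 'M[R]_(n, p)) :
  exact_at d1 d0 -> exact_at d1 (- d0).
Proof.
move=> ex v; rewrite mulmxN; split=> [/eqP|/ex ->]; last by rewrite oppr0.
by rewrite oppr_eq0 => /eqP /ex.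
Qed.

(** If [(a, b)] is a cycle of the cone, [b] lifts to some [b'] through [e1]; the anticommuting
    square then makes [a - b' *m k1] a cycle of [d0], which lifts in turn. *)
Lemma cone_exact (a2 a1 a0 b2 b1 b0 : nat)
    (d1 : 'M[R]_(a2, a1)) (d0 : 'M[R]_(a1, a0))
    (e1 : 'M[R]_(b2, b1)) (e0 : 'M[R]_(b1, b0))
    (k1 : 'M[R]_(b2, a1)) (k0 : 'M[R]_(b1, a0)) :
  exact_at d1 d0 -> exact_at e1 e0 -> k1 *m d0 + e1 *m k0 = 0 ->
  exact_at (block_mx d1 0 k1 e1) (block_mx d0 0 k0 e0).
Proof.
move=> exd exe ke v; split=> [|[w ->]]; last first.
  rewrite -mulmxA mulmx_block !mulmx0 !mul0mx !addr0 ke.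
  by rewrite (exact_mul0 exd) (exact_mul0 exe) addr0 block_mx0 mulmx0.
rewrite -[v]hsubmxK mul_row_block mulmx0 add0r.
move: (lsubmx v) (rsubmx v) => a b /eqP; rewrite row_mx_eq0.
case/andP => /eqP ab0 /eqP /exe [b' Eb].
have /exd [a' Ea] : (a - b' *m k1) *m d0 = 0.
  rewrite mulmxBl -mulmxA; move: ke => /eqP; rewrite addr_eq0 => /eqP ->.
  by rewrite mulmxN opprK mulmxA -Eb.
exists (row_mx a' b'); rewrite mul_row_block mulmx0 add0r -Eb.
by rewrite -Ea subrK.
Qed.

(** The bottom end of a cone: a cycle [(a, b)] satisfies [a *m d0 + b *m k0 = 0], so [b *m k0] lies
    in the image of [d0]. A colon condition thus takes the place of exactness of the second
    complex. *)
Lemma cone_exact_aug (a2 a1 a0 b2 b1 : nat)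
    (d1 : 'M[R]_(a2, a1)) (d0 : 'M[R]_(a1, a0))
    (e1 : 'M[R]_(b2, b1)) (k1 : 'M[R]_(b2, a1)) (k0 : 'M[R]_(b1, a0)) :
  exact_at d1 d0 -> k1 *m d0 + e1 *m k0 = 0 ->
  (forall v : 'rV_b1, (exists u, v *m k0 = u *m d0) -> exists w, v = w *m e1) ->
  exact_at (block_mx d1 0 k1 e1) (col_mx d0 k0).
Proof.
move=> exd ke colon v; split=> [|[w ->]]; last first.
  rewrite -mulmxA mul_block_col !mul0mx addr0 ke (exact_mul0 exd).
  by rewrite col_mx0 mulmx0.
rewrite -[v]hsubmxK mul_row_col; move: (lsubmx v) (rsubmx v) => a b ab0.
have [|b' Eb] := colon b.
  exists (- a); rewrite mulNmx; apply/eqP.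
  by rewrite -addr_eq0 addrC ab0.
have /exd [a' Ea] : (a - b' *m k1) *m d0 = 0.
  rewrite mulmxBl -mulmxA; move: ke => /eqP; rewrite addr_eq0 => /eqP ->.
  by rewrite mulmxN opprK mulmxA -Eb.
exists (row_mx a' b'); rewrite mul_row_block mulmx0 add0r -Eb.
by rewrite -Ea subrK.
Qed.

(** Comparison theorem for free modules: once the first lift exists, exactness of the target
    supplies all later ones. *)
Lemma chain_map_lift (rF rG : nat -> nat)
    (dF : forall i, 'M[R]_(rF i.+1, rF i)) (dG : forall i, 'M[R]_(rG i.+1, rG i))
    (k0 : 'M[R]_(rF 0%N, rG 0%N)) :
  (forall i, dF i.+1 *m dF i = 0) ->
  (forall i, exact_at (dG i.+1) (dG i)) ->
  (exists k1, dF 0%N *m k0 = k1 *m dG 0%N) ->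
  exists2 k : forall i, 'M[R]_(rF i, rG i), k 0%N = k0 &
    forall i, k i.+1 *m dG i = dF i *m k i.
Proof.
move=> dF0 exG lift0.
(* The recursion carries the proof that the current map lifts once more; [sig_eqW] extracts actual
   matrices, so that the lifts form a function of the index. *)
pose P i (k : 'M[R]_(rF i, rG i)) := exists k', dF i *m k = k' *m dG i.
have next i k : P i k -> {k' | k' *m dG i = dF i *m k & P i.+1 k'}.
  move=> /sig_eqW [k' Ek]; exists k' => //.
  apply: exact_lift (exG i) _.
  by rewrite -mulmxA -Ek mulmxA dF0 mul0mx.
pose st := nat_rect (fun i => {k | P i k}) (exist _ k0 lift0)
  (fun i x => let: exist2 k' _ pk' := next i (sval x) (svalP x) in exist _ k' pk').
exists (fun i => sval (st i)) => // i.
by rewrite /=; case: (next _ _ _).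
Qed.

(** The homotopy starts from 0 because [k] vanishes at index 0. Two consecutive components at a time
    suffice to compare homology at a single index. *)
Lemma null_homotopy (rF rG : nat -> nat)
    (dF : forall i, 'M[R]_(rF i.+1, rF i)) (dG : forall i, 'M[R]_(rG i.+1, rG i))
    (k : forall i, 'M[R]_(rF i, rG i)) :
  (forall i, dF i.+1 *m dF i = 0) ->
  (forall i, exact_at (dG i.+1) (dG i)) ->
  (forall i, k i.+1 *m dG i = dF i *m k i) -> k 0%N = 0 ->
  forall i, exists s : 'M[R]_(rF i, rG i.+1), exists s' : 'M[R]_(rF i.+1, rG i.+2),
    k i.+1 = s' *m dG i.+1 + dF i *m s /\ (i = 0%N -> s = 0).
Proof.
move=> dF0 exG kd k0; elim=> [|i [s [s' [Ek _]]]].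
  have [s' Es] : exists s', k 1%N = s' *m dG 1%N.
    by apply: exact_lift (exG 0%N) _; rewrite kd k0 mulmx0.
  by exists 0, s'; rewrite mulmx0 addr0.
have [t Et] : exists t, k i.+2 - dF i.+1 *m s' = t *m dG i.+2.
  apply: exact_lift (exG i.+1) _; rewrite mulmxBl kd Ek mulmxDr !mulmxA.
  by rewrite dF0 mul0mx addr0 subrr.
by exists s', t; split=> //; rewrite -Et subrK.
Qed.

End Exactness.

(** * Ranks of homology and of graded pieces over a field *)

Section HomologyRank.
Variable K : fieldType.

(** The homotopy shows that every cycle is in the image of [g] up to a boundary. Since [f] retracts
    [g] and kills boundaries, the sum is direct and [g] has rank [b]. *)
Lemma homology_rank (a2 a1 a0 b : nat)
    (d1 : 'M[K]_(a2, a1)) (d0 : 'M[K]_(a1, a0))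
    (f : 'M[K]_(a1, b)) (g : 'M[K]_(b, a1))
    (s : 'M[K]_(a1, a2)) (t : 'M[K]_(a0, a1)) :
  d1 *m d0 = 0 -> g *m f = 1%:M -> f *m g = 1%:M + (s *m d1 + d0 *m t) ->
  g *m d0 = 0 -> d1 *m f = 0 -> \rank (kermx d0) = (b + \rank d1)%N.
Proof.
move=> d10 gf fg gd df.
have eqK : (kermx d0 :=: g + d1)%MS.
  apply/eqmxP/andP; split; last first.
    by rewrite addsmx_sub; apply/andP; split; apply/sub_kermxP.
  have -> : kermx d0 = kermx d0 *m (f *m g) - kermx d0 *m s *m d1.
    by rewrite fg !mulmxDr mulmx1 !mulmxA mulmx_ker mul0mx addr0 addrK.
  rewrite mulmxA -mulNmx.
  exact: addmx_sub_adds (submxMl _ _) (submxMl _ _).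
have dis : (g :&: d1 = 0)%MS.
  apply/eqP/rowV0P => v; rewrite sub_capmx => /andP[/submxP[u Eu] /submxP[w Ew]].
  have u0 : u = 0 by rewrite -[u]mulmx1 -gf mulmxA -Eu Ew -mulmxA df mulmx0.
  by rewrite Eu u0 mul0mx.
rewrite eqK mxrank_disjoint_sum //; congr (_ + _)%N.
apply/eqP; apply/row_freeP; by exists f.
Qed.

(* The orthogonal idempotents e j grade the row space of X. *)
Lemma rank_split (T : eqType) (p q : nat) (X : 'M[K]_(p, q)) (e : T -> 'M[K]_q)
    (s : seq T) :
  uniq s -> (forall j, e j *m e j = e j) ->
  (forall i j, i != j -> e i *m e j = 0) ->
  (forall j, X *m e j <= X)%MS ->
  \rank (X *m \sum_(j <- s) e j) = (\sum_(j <- s) \rank (X *m e j))%N.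
Proof.
move=> + ee e0 Xe; elim: s => [|j s IH] /=.
  by rewrite !big_nil mulmx0 mxrank0.
case/andP => js us; move: (IH us) => {}IH; rewrite !big_cons -IH.
set E := \sum_(_ <- s) _ in IH *.
have eE : e j *m E = 0.
  rewrite mulmx_sumr big_seq big1 // => i si; apply: e0.
  by apply: contraNneq js => ->.
have Ee : E *m e j = 0.
  rewrite mulmx_suml big_seq big1 // => i si; apply: e0.
  by apply: contraNneq js => <-.
have EE : E *m E = E.
  rewrite {1}/E mulmx_suml [RHS]big_seq [LHS]big_seq; apply: eq_bigr => i si.
  rewrite mulmx_sumr (bigD1_seq i) //= ee big1 ?addr0 // => k ki.
  by rewrite e0 // eq_sym.
have XE : (X *m E <= X)%MS.
  rewrite mulmx_sumr; apply: summx_sub => i _; exact: Xe.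
have absorb (Y : 'M[K]_q) : (X *m Y <= X)%MS -> Y *m (e j + E) = Y ->
    (X *m Y <= X *m (e j + E))%MS.
  by move=> XY YE; rewrite -YE mulmxA; apply: submxMr.
have eqS : (X *m (e j + E) :=: X *m e j + X *m E)%MS.
  apply/eqmxP/andP; split; first by rewrite mulmxDr; apply: addmx_sub_adds.
  rewrite addsmx_sub absorb ?absorb // mulmxDr ?ee ?eE ?Ee ?EE ?addr0 ?add0r //.
rewrite eqS mxrank_disjoint_sum //.
apply/eqP/rowV0P => v; rewrite sub_capmx => /andP[/submxP[u Eu] /submxP[w Ew]].
have -> : v = v *m e j by rewrite Eu -!mulmxA ee.
by rewrite Ew -!mulmxA Ee !mulmx0.
Qed.

End HomologyRank.

(** * Tor and minimal resolutions *)

Section Augmentation.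
Variables (K : fieldType) (n : nat).

Lemma ext_eps_additive : zmod_morphism (@ext_eps K n).
Proof. by move=> x y; rewrite /ext_eps !ffunE. Qed.

Lemma ext_eps_multiplicative : monoid_morphism (@ext_eps K n).
Proof.
split=> [|x y]; first by rewrite /ext_eps ffunE eqxx.
rewrite /ext_eps extE ffunE (bigD1 set0) //= big1 => [|A /andP[]].
  by rewrite addr0 setD0 shuffle_inv0l expr0 mul1r.
by rewrite subset0 => /eqP ->; rewrite eqxx.
Qed.

HB.instance Definition _ := GRing.isZmodMorphism.Build (ext K n) K
  (@ext_eps K n) ext_eps_additive.
HB.instance Definition _ := GRing.isMonoidMorphism.Build (ext K n) K
  (@ext_eps K n) ext_eps_multiplicative.

Lemma ext_eps_homogeneous (d : int) (x : ext K n) :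
  homogeneous d x -> d != 0 -> ext_eps x = 0.
Proof.
move=> hx d0; apply/eqP; apply: contraNT d0 => /hx.
by rewrite cards0 => <-.
Qed.

End Augmentation.

Section Comparison.
Variables (K : fieldType) (n : nat).
Implicit Types (F G : graded_free K n) (J : ext K n -> Prop).

(* The augmented complex ... -> F_1 -> F_0 -> E, with E placed at index 0. *)
Definition full_rank F (i : nat) : nat := if i is j.+1 then gf_rank F j else 1%N.

Definition full_dif F (i : nat) :
    'M[ext K n]_(full_rank F i.+1, full_rank F i) :=
  match i with 0 => gf_aug F | j.+1 => gf_dif F j end.

Lemma resolves_exact F J i :
  resolves F J -> exact_at (full_dif F i.+1) (full_dif F i).
Proof. by case=> _ _ _ e0 e; case: i => [|i]; [apply: e0 | apply: e]. Qed.

Lemma resolves_dif_mul0 F J i :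
  resolves F J -> full_dif F i.+1 *m full_dif F i = 0.
Proof. by move=> rF; apply: exact_mul0 (@resolves_exact F J i rF). Qed.

Lemma resolves_chain_map F G J : resolves F J -> resolves G J ->
  exists2 k : forall i, 'M[ext K n]_(full_rank F i, full_rank G i), k 0%N = 1%:M &
    forall i, k i.+1 *m full_dif G i = full_dif F i *m k i.
Proof.
move=> rF rG.
have dF0 i : full_dif F i.+1 *m full_dif F i = 0 := @resolves_dif_mul0 F J i rF.
have exG i : exact_at (full_dif G i.+1) (full_dif G i) := @resolves_exact G J i rG.
apply: (chain_map_lift dF0 exG) => /=.
rewrite mulmx1; apply: lift_rows => i.
have /(aug_exact rG) [w Ew] : J (gf_aug F i 0).
  apply/(aug_exact rF); exists (delta_mx 0 i); rewrite -rowE.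
  by apply/rowP => j; rewrite !mxE ord1 eqxx.
exists w; rewrite Ew; apply/rowP => j; by rewrite !mxE ord1 eqxx.
Qed.

(** At index 0 the outgoing map is 0 and not the augmentation: [F] resolves the ideal itself, so
    everything in homological degree 0 is a cycle. *)
Definition tor_prev F (i : nat) : 'M[K]_(gf_rank F i, full_rank F i) :=
  match i with 0 => 0 | j.+1 => tor_dif F j end.

(** The comparison maps between [F] and [G] are inverse up to homotopy. Over [K] the differentials
    of [G] vanish, so the composite on [G] becomes the identity and [homology_rank] applies. *)
Lemma tor_homology_rank F G J i : resolves F J -> resolves G J ->
  (forall j, tor_dif G j = 0) ->
  \rank (kermx (tor_prev F i)) = (gf_rank G i + \rank (tor_dif F i))%N.
Proof.
move=> rF rG minG.
have [f f0 fd] := resolves_chain_map rF rG.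
have [g g0 gd] := resolves_chain_map rG rF.
have dF0 j := @resolves_dif_mul0 F J j rF; have dG0 j := @resolves_dif_mul0 G J j rG.
have exF j := @resolves_exact F J j rF; have exG j := @resolves_exact G J j rG.
have [||s [s' [Es s0]]] :=
  null_homotopy (k := fun j => f j *m g j - 1%:M) dF0 exF _ _ i.
- by move=> j; rewrite mulmxBl mulmxBr mulmx1 mul1mx mulmxA -fd -!mulmxA gd.
- by rewrite f0 g0 mulmx1 subrr.
have [||t [t' [Et t0]]] :=
  null_homotopy (k := fun j => g j *m f j - 1%:M) dG0 exG _ _ i.
- by move=> j; rewrite mulmxBl mulmxBr mulmx1 mul1mx mulmxA -gd -!mulmxA fd.
- by rewrite f0 g0 mulmx1 subrr.
pose e := @ext_eps K n.
(* At index 0 the augmentation may survive over [K] (if the ideal contains a unit), but there the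
   homotopy component [s] is 0. *)
have prevF : map_mx e (full_dif F i *m s) = tor_prev F i *m map_mx e s.
  case: (i) s s0 {s' Es t t' Et t0} => [|j] s s0; last by rewrite map_mxM.
  by rewrite (s0 erefl) !raddf0.
have prevG : map_mx e (full_dif G i *m t) = 0.
  case: (i) t t0 {s s' Es s0 t' Et prevF} => [|j] t t0.
    by rewrite (t0 erefl) mulmx0 raddf0.
  by rewrite map_mxM /= [map_mx _ _](minG j) mul0mx.
apply: (@homology_rank _ _ _ _ _ _ _ (map_mx e (f i.+1)) (map_mx e (g i.+1))
  (map_mx e s') (map_mx e s)).
- case: (i) => [|j]; first by rewrite mulmx0.
  rewrite /= -map_mxM; have /= -> := dF0 j.+1; by rewrite raddf0.
- apply/eqP; rewrite -subr_eq0; apply/eqP.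
  rewrite -(map_mx1 e) -map_mxM -raddfB Et raddfD /= prevG map_mxM /=.
  by rewrite [map_mx _ (gf_dif _ _)](minG i) mulmx0 addr0.
- rewrite -map_mxM -[_ *m _](subrK 1%:M) Es raddfD /= map_mx1 raddfD /= prevF.
  by rewrite map_mxM addrC.
- case: (i) => [|j]; first by rewrite mulmx0.
  rewrite /= -map_mxM; have /= -> := gd j.+1; rewrite map_mxM.
  by rewrite [map_mx _ (gf_dif _ _)](minG j) mul0mx.
- rewrite /= -map_mxM; have /= <- := fd i.+1; rewrite map_mxM.
  by rewrite [map_mx _ (gf_dif _ _)](minG i) mulmx0.
Qed.

Lemma tor_chains_idem F i j : tor_chains F i j *m tor_chains F i j = tor_chains F i j.
Proof.
rewrite mulmx_diag; congr diag_mx; apply/rowP => k; rewrite !mxE.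
by case: eqP; rewrite ?mulr1 ?mulr0.
Qed.

Lemma tor_chains_orth F i j j' :
  j != j' -> tor_chains F i j *m tor_chains F i j' = 0.
Proof.
move=> jk; apply/matrixP => k l; rewrite mulmx_diag !mxE.
case: eqP => [->|_]; rewrite ?mul0r ?mul0rn //.
by rewrite (negPf jk) mulr0 mul0rn.
Qed.

Lemma tor_chains_sum F i :
  \sum_(j <- undup (codom (gf_deg F i))) tor_chains F i j = 1%:M.
Proof.
apply/matrixP => k l; rewrite summxE mxE.
rewrite (bigD1_seq (gf_deg F i k)) ?undup_uniq ?mem_undup ?codom_f //=.
rewrite !mxE eqxx big1 ?addr0 // => j jk; rewrite !mxE [_ == j]eq_sym.
by rewrite (negPf jk) mul0rn.
Qed.

(** An entry joining basis vectors of distinct degrees is homogeneous of nonzero degree, hence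
    killed by [ext_eps]. *)
Lemma tor_dif_graded F J i j : resolves F J ->
  tor_chains F i.+1 j *m tor_dif F i = tor_dif F i *m tor_chains F i j.
Proof.
move=> rF; rewrite mul_diag_mx mul_mx_diag; apply/matrixP => k l; rewrite !mxE.
have [E|ne] := eqVneq (gf_deg F i.+1 k) (gf_deg F i l).
  by rewrite E mulrC.
rewrite (@ext_eps_homogeneous _ _ (gf_deg F i.+1 k - gf_deg F i l)) ?mulr0 ?mul0r //.
- exact: (dif_homogeneous rF).
- by rewrite subr_eq0.
Qed.

(** Cycles and boundaries are stable under the orthogonal degree projectors [tor_chains], so their
    ranks add up over the degrees and the grading can be forgotten. *)
Lemma tor_total_dimE F J i : resolves F J ->
  tor_total_dim F i = (\rank (kermx (tor_prev F i)) - \rank (tor_dif F i))%N.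
Proof.
move=> rF; pose D := undup (codom (gf_deg F i)).
have splitX p (X : 'M_(p, gf_rank F i)) :
    (forall j, X *m tor_chains F i j <= X)%MS ->
    \rank X = (\sum_(j <- D) \rank (X *m tor_chains F i j))%N.
  move=> stX; rewrite -[in LHS](mulmx1 X) -tor_chains_sum.
  apply: rank_split => //; first exact: undup_uniq.
  - exact: tor_chains_idem.
  - by move=> j k; apply: tor_chains_orth.
have stB j : (tor_dif F i *m tor_chains F i j <= tor_dif F i)%MS.
  by rewrite -(tor_dif_graded _ _ rF) submxMl.
have stZ j : (kermx (tor_prev F i) *m tor_chains F i j <= kermx (tor_prev F i))%MS.
  apply/sub_kermxP; case: (i) => [|k] /=; first by rewrite mulmx0.
  by rewrite -mulmxA (tor_dif_graded _ _ rF) mulmxA mulmx_ker mul0mx.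
have BZ : (tor_dif F i <= kermx (tor_prev F i))%MS.
  apply/sub_kermxP; case: (i) => [|k] /=; first by rewrite mulmx0.
  by rewrite -map_mxM; have /= -> := @resolves_dif_mul0 F J k.+1 rF; rewrite raddf0.
have cycE j : (tor_cycles F i j :=: kermx (tor_prev F i) *m tor_chains F i j)%MS.
  case: (i) stZ => [|k] stZ /=.
    apply/eqmx_sym/(eqmx_trans (eqmxMr _ (kermx0 _ _ _))); by rewrite mul1mx.
  apply/eqmxP/andP; split; last by rewrite sub_capmx submxMl stZ.
  apply/rV_subP => v; rewrite sub_capmx => /andP[/submxP [u Eu] vK].
  have -> : v = v *m tor_chains F k.+1 j by rewrite Eu -mulmxA tor_chains_idem.
  exact: submxMr.
rewrite /tor_total_dim (splitX _ _ stB) (splitX _ _ stZ) -sumnB; last first.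
  by move=> j _; apply/mxrankS/submxMr.
by apply: eq_bigr => j _; rewrite /tor_dim cycE /tor_boundaries (tor_dif_graded _ _ rF).
Qed.

Lemma betti_number_minimal G J i : resolves G J ->
  (forall j, tor_dif G j = 0) -> betti_number J i (gf_rank G i).
Proof.
move=> rG minG; split=> [|F rF]; first by exists G.
by rewrite (tor_total_dimE _ rF) (tor_homology_rank _ rF rG minG) addnK.
Qed.

End Comparison.

(** * Linear resolutions *)

Section Homogeneous.
Variables (K : fieldType) (n : nat).
Implicit Types (x y : ext K n) (d e : nat).

Lemma homogeneous0 (d : int) : homogeneous d (0 : ext K n).
Proof. by move=> S; rewrite ffunE eqxx. Qed.

Lemma homogeneousD (d : int) x y :
  homogeneous d x -> homogeneous d y -> homogeneous d (x + y).
Proof.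
move=> hx hy S; rewrite ffunE; have [x0|/hx //] := eqVneq (x S) 0.
by rewrite x0 add0r => /hy.
Qed.

Lemma homogeneousZ (d : int) (c : K) x : homogeneous d x -> homogeneous d (c *: x).
Proof.
move=> hx S; rewrite ffunE => cx; apply: hx; apply: contraNneq cx => ->.
by rewrite scaler0.
Qed.

Lemma homogeneousN (d : int) x : homogeneous d x -> homogeneous d (- x).
Proof. by move=> hx; rewrite -scaleN1r; apply: homogeneousZ. Qed.

Lemma homogeneous_sum (d : int) (I : Type) (s : seq I) (P : pred I) (f : I -> ext K n) :
  (forall i, P i -> homogeneous d (f i)) -> homogeneous d (\sum_(i <- s | P i) f i).
Proof.
move=> hf; apply: big_ind => //; first exact: homogeneous0.
by move=> x y; apply: homogeneousD.
Qed.

Lemma homogeneous_extb (S : {set 'I_n}) : homogeneous #|S|%:Z (extb K S).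
Proof. by move=> T; rewrite ffunE; have [->|_] := eqVneq T S; rewrite ?eqxx. Qed.

Lemma ext_mul_support x y (S : {set 'I_n}) : (x * y) S != 0 ->
  exists A : {set 'I_n}, [/\ A \subset S, x A != 0 & y (S :\: A) != 0].
Proof.
rewrite extE ffunE => xyS.
have /exists_inP [A AS /andP[xA yA]] :
    [exists (A : {set 'I_n} | A \subset S), (x A != 0) && (y (S :\: A) != 0)].
  apply: contraNT xyS => /exists_inPn H.
  rewrite big1 // => A /H; rewrite negb_and !negbK => /orP[]/eqP ->.
    by rewrite mulr0 mul0r.
  by rewrite mulr0.
by exists A.
Qed.

Lemma homogeneousM d e x y :
  homogeneous d%:Z x -> homogeneous e%:Z y -> homogeneous (d + e)%:Z (x * y).
Proof.
move=> hx hy S /ext_mul_support [A [AS xA yA]].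
rewrite -(cardsID A S) (setIidPr AS).
by have [->] := hx _ xA; have [->] := hy _ yA.
Qed.

(** Serves to replace a chain map by a homogeneous one. *)
Definition hcomp d x : ext K n := [ffun S : {set 'I_n} => if #|S| == d then x S else 0].

Lemma hcomp_additive d : zmod_morphism (hcomp d).
Proof. by move=> x y; apply/ffunP => S; rewrite !ffunE; case: ifP; rewrite ?subr0. Qed.

HB.instance Definition _ d := GRing.isZmodMorphism.Build (ext K n) (ext K n)
  (hcomp d) (hcomp_additive d).

Lemma hcomp_homogeneous d x : homogeneous d%:Z (hcomp d x).
Proof. by move=> S; rewrite ffunE; have [->//|_] := eqVneq #|S| d; rewrite eqxx. Qed.

Lemma hcomp_id d x : homogeneous d%:Z x -> hcomp d x = x.
Proof.
move=> hx; apply/ffunP => S; rewrite ffunE; case: eqP => // ne.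
by have [//|/hx [/ne]] := eqVneq (x S) 0.
Qed.

Lemma hcomp_mul d x y (S : {set 'I_n}) : hcomp d (x * y) S =
  \sum_(A : {set 'I_n} | A \subset S) (if #|S| == d then
     (-1) ^+ shuffle_inv A (S :\: A) * (x A : K) * (y (S :\: A) : K) else 0).
Proof. by rewrite extE !ffunE; case: (#|S| == d); rewrite ?big1_eq. Qed.

Lemma hcompMr d e x y : homogeneous e%:Z y -> hcomp (d + e) (x * y) = hcomp d x * y.
Proof.
move=> hy; apply/ffunP => S; rewrite hcomp_mul extE ffunE.
apply: eq_bigr => A AS; rewrite ffunE.
have [->|/hy [Ey]] := eqVneq (y (S :\: A)) 0; first by rewrite !mulr0 if_same.
rewrite -(cardsID A S) (setIidPr AS) Ey eqn_add2r.
by case: (#|A| == d); rewrite // mulr0 mul0r.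
Qed.

Lemma hcompMl d e x y : homogeneous d%:Z x -> hcomp (d + e) (x * y) = x * hcomp e y.
Proof.
move=> hx; apply/ffunP => S; rewrite hcomp_mul extE ffunE.
apply: eq_bigr => A AS; rewrite ffunE.
have [->|/hx [Ex]] := eqVneq (x A) 0; first by rewrite !mulr0 !mul0r if_same.
rewrite -(cardsID A S) (setIidPr AS) Ex eqn_add2l.
by case: (#|S :\: A| == e); rewrite // mulr0.
Qed.

Lemma mulmx_scalarE (R : nzRingType) p q (X : 'M[R]_(p, q)) (g : R) i j :
  (X *m g%:M) i j = X i j * g.
Proof.
rewrite mxE (bigD1 j) //= mxE eqxx big1 ?addr0 // => k kj.
by rewrite mxE (negPf kj) mulr0.
Qed.

Definition mx_homogeneous (d : int) p q (X : 'M[ext K n]_(p, q)) : Prop :=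
  forall i j, homogeneous d (X i j).

Lemma map_hcompMr d e p q r (X : 'M[ext K n]_(p, q)) (Y : 'M_(q, r)) :
  mx_homogeneous e%:Z Y -> map_mx (hcomp (d + e)) (X *m Y) = map_mx (hcomp d) X *m Y.
Proof.
move=> hY; apply/matrixP => i j; rewrite !mxE raddf_sum; apply: eq_bigr => k _.
by rewrite /= hcompMr ?mxE.
Qed.

Lemma map_hcompMl d e p q r (X : 'M[ext K n]_(p, q)) (Y : 'M_(q, r)) :
  mx_homogeneous d%:Z X -> map_mx (hcomp (d + e)) (X *m Y) = X *m map_mx (hcomp e) Y.
Proof.
move=> hX; apply/matrixP => i j; rewrite !mxE raddf_sum; apply: eq_bigr => k _.
by rewrite /= hcompMl ?mxE.
Qed.

Lemma mx_homogeneous_col d p1 p2 q (X : 'M[ext K n]_(p1, q)) (Y : 'M_(p2, q)) :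
  mx_homogeneous d X -> mx_homogeneous d Y -> mx_homogeneous d (col_mx X Y).
Proof. by move=> hX hY i j; rewrite mxE; case: split => k. Qed.

Lemma mx_homogeneous_row d p q1 q2 (X : 'M[ext K n]_(p, q1)) (Y : 'M_(p, q2)) :
  mx_homogeneous d X -> mx_homogeneous d Y -> mx_homogeneous d (row_mx X Y).
Proof. by move=> hX hY i j; rewrite mxE; case: split => k. Qed.

Lemma mx_homogeneous0 d p q : mx_homogeneous d (0 : 'M[ext K n]_(p, q)).
Proof. by move=> i j; rewrite mxE; apply: homogeneous0. Qed.

Lemma mx_homogeneousN d p q (X : 'M[ext K n]_(p, q)) :
  mx_homogeneous d X -> mx_homogeneous d (- X).
Proof. by move=> hX i j; rewrite mxE; apply: homogeneousN. Qed.

Lemma mx_homogeneous_scalar d p x :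
  homogeneous d x -> mx_homogeneous d (x%:M : 'M[ext K n]_p).
Proof.
move=> hx i j; rewrite mxE; case: eqP => _; rewrite ?mulr1n //.
exact: homogeneous0.
Qed.

Lemma mx_homogeneous_block d p1 p2 q1 q2 (X : 'M[ext K n]_(p1, q1))
    (Y : 'M_(p1, q2)) (Z : 'M_(p2, q1)) (T : 'M_(p2, q2)) :
  mx_homogeneous d X -> mx_homogeneous d Y -> mx_homogeneous d Z ->
  mx_homogeneous d T -> mx_homogeneous d (block_mx X Y Z T).
Proof. by move=> *; apply: mx_homogeneous_col; apply: mx_homogeneous_row. Qed.

End Homogeneous.

Section LinearResolutions.
Variables (K : fieldType) (n : nat).
Implicit Types (F G C : graded_free K n) (J P : ext K n -> Prop) (m : nat).

Definition has_linear_res m J (r : nat -> nat) : Prop :=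
  exists F, [/\ resolves F J, forall i k, gf_deg F i k = (m + i)%:Z & gf_rank F =1 r].

Lemma eq_linear_res m J J' r r' : (forall x, J x <-> J' x) -> r =1 r' ->
  has_linear_res m J r -> has_linear_res m J' r'.
Proof.
move=> eJ er [F [[h1 h2 h3 h4 h5] dF rF]]; exists F; split=> //; last first.
  by move=> i; rewrite rF er.
by split=> // x; split=> [/eJ/h3|/h3/eJ].
Qed.

(** The entries of the differentials have degree 1, so they vanish over [K] and the resolution is
    minimal. *)
Lemma linear_res_betti m J r i : has_linear_res m J r -> betti_number J i (r i).
Proof.
move=> [F [rF dF <-]]; apply: betti_number_minimal (rF) _ => j.
apply/matrixP => k l; rewrite !mxE.
apply: (@ext_eps_homogeneous _ _ 1) => //.
have := @dif_homogeneous _ _ F J rF _ k l; rewrite !dF addnS -addn1 PoszD.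
by rewrite addrAC subrr add0r.
Qed.

Lemma full_dif_homogeneous m F J i :
  resolves F J -> (forall i k, gf_deg F i k = (m + i)%:Z) ->
  mx_homogeneous (if i is 0 then m else 1%N)%:Z (full_dif F i).
Proof.
move=> rF dF k l; case: i k l => [|i] k l.
  by rewrite ord1; have := @aug_homogeneous _ _ F J rF k; rewrite dF addn0.
have := @dif_homogeneous _ _ F J rF _ k l; rewrite !dF addnS -addn1 PoszD.
by rewrite addrAC subrr add0r.
Qed.

(* The resolution of J + E g is the cone of a chain map from the resolution C
   of the colon ideal P to the resolution F of J that lifts multiplication by g;
   taking the homogeneous part of degree 1 keeps it linear. *)
Lemma linear_res_cone m J P (g : ext K n) r c :
  has_linear_res m J r -> has_linear_res 1 P c -> homogeneous m%:Z g ->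
  (forall v, J (v * g) <-> P v) ->
  has_linear_res m (fun x => exists2 x', J x' & exists v, x = x' + v * g)
    (fun i => (r i + if i is j.+1 then c j else 1)%N).
Proof.
move=> [F [rF dF er]] [C [rC dC ec]] hg colon.
have dC0 j := @resolves_dif_mul0 _ _ C P j rC.
have exF j := @resolves_exact _ _ F J j rF; have exC j := @resolves_exact _ _ C P j rC.
have hF i := @full_dif_homogeneous m F J i rF dF.
have hC i : mx_homogeneous 1 (full_dif C i).
  by have := @full_dif_homogeneous 1 C P i rC dC; case: i.
have [|k k0 kd] := @chain_map_lift _ (full_rank C) (full_rank F)
    (full_dif C) (full_dif F) g%:M dC0 exF.
  apply: lift_rows => i.
  have /colon/(aug_exact rF) [w Ew] : P (gf_aug C i 0).
    apply/(aug_exact rC); exists (delta_mx 0 i); rewrite -rowE.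
    by apply/rowP => j; rewrite !mxE ord1 eqxx.
  exists w; rewrite Ew; apply/rowP => j.
  by rewrite mxE mulmx_scalarE !mxE ord1 eqxx.
(* At index 0 the map is [g], of degree [m]. Afterwards a generator of [C] shifted by [m] has degree
   [m + i + 1] and maps to generators of degree [m + i]. *)
pose kap (i : nat) := if i is 0 then m else 1%N.
pose h i := map_mx (@hcomp K n (kap i)) (k i).
have hh i : mx_homogeneous (kap i)%:Z (h i).
  by move=> a b; rewrite mxE; apply: hcomp_homogeneous.
have h0 : h 0%N = g%:M.
  apply/matrixP => a b; rewrite mxE k0 hcomp_id //; exact: mx_homogeneous_scalar.
have hd i : h i.+1 *m full_dif F i = full_dif C i *m h i.
  rewrite /h /= -(@map_hcompMr _ _ 1 (kap i)); last exact: hF.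
  by rewrite kd (@map_hcompMl _ _ 1 (kap i)) //; exact: hC.
(* The copy of [E] at index 0 of the augmented [C] carries the new generator [g]; the sign on [C]
   makes the squares anticommute. *)
pose N := @GradedFree K n (fun i => (gf_rank F i + full_rank C i)%N)
  (fun i _ => (m + i)%:Z) (col_mx (gf_aug F) (g%:M : 'M_(full_rank C 0)))
  (fun i => block_mx (gf_dif F i) 0 (h i.+1) (- full_dif C i)).
exists N; split=> //; last by move=> [|i]; rewrite /= er ?ec.
split=> /=.
- move=> i; rewrite addn0; apply: mx_homogeneous_col; first exact: (hF 0%N).
  exact: mx_homogeneous_scalar.
- move=> i a b; rewrite addnS -addn1 PoszD addrAC subrr add0r.
  apply: mx_homogeneous_block.
  + exact: (hF i.+1).
  + exact: mx_homogeneous0.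
  + exact: (hh i.+1).
  + exact/mx_homogeneousN/hC.
- move=> x; split=> [[x' /(aug_exact rF) [w Ew] [v ->]]|[w]].
    exists (row_mx w v%:M); rewrite mul_row_col Ew -scalar_mxM.
    by rewrite -raddfD.
  rewrite -[w]hsubmxK mul_row_col => Ew.
  exists ((lsubmx w *m gf_aug F) 0 0).
    apply/(aug_exact rF); exists (lsubmx w).
    by apply/matrixP => a b; rewrite !mxE !ord1 eqxx mulr1n.
  exists (rsubmx w 0 0); move/matrixP/(_ 0 0): Ew; rewrite [in RHS]mxE eqxx mulr1n => <-.
  by rewrite mxE; rewrite mulmx_scalarE.
- apply: cone_exact_aug; first exact: (exF 0%N).
    by rewrite mulNmx -[X in _ - _ *m X]h0 -(hd 0%N) subrr.
  move=> v [u Eu].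
  have /(aug_exact rC) [w Ew] : P (v 0 0).
    apply/colon/(aug_exact rF); exists u; rewrite -[_ *m _]Eu.
    by apply/matrixP => a b; rewrite !ord1 mulmx_scalarE !mxE eqxx.
  exists (- w); rewrite mulNmx mulmxN opprK; apply/matrixP => a b.
  by rewrite -[_ *m full_dif C 0]/(w *m gf_aug C) Ew !mxE !ord1 eqxx.
- move=> i; apply: cone_exact; first exact: (exF i.+1).
    exact/exact_oppl/exact_oppr/exC.
  by rewrite mulNmx -(hd i.+1) subrr.
Qed.

End LinearResolutions.

(** * The Cartan resolution of a linear monomial ideal *)

Lemma setDUK (T : finType) (S U : {set T}) : U \subset S -> S :\: U :|: U = S.
Proof. by move=> US; rewrite setUC -{1}(setIidPr US) setID. Qed.

Section MonomialIdeals.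
Variables (K : fieldType) (n : nat).
Implicit Types (x y v : ext K n) (S T U : {set 'I_n}) (Q : pred {set 'I_n}) (a : 'I_n).

Lemma ext_sumE x : x = \sum_(S : {set 'I_n}) x S *: extb K S.
Proof.
apply/ffunP => S; rewrite sum_ffunE (bigD1 S) //= !ffunE eqxx [_ *: _]mulr1.
rewrite big1 ?addr0 // => T TS; rewrite !ffunE eq_sym (negPf TS).
by rewrite [_ *: _]mulr0.
Qed.

Lemma homogeneous1_anticomm x a :
  homogeneous 1 x -> extb K [set a] * x = - (x * extb K [set a]).
Proof.
move=> hx; rewrite [x]ext_sumE mulr_suml mulr_sumr -sumrN; apply: eq_bigr => S _.
rewrite -scalerAl -scalerAr; have [->|/hx [/eqP/cards1P [j ->]]] := eqVneq (x S) 0.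
  by rewrite !scale0r oppr0.
by rewrite extb_anticomm scalerN.
Qed.

Lemma ext_mul_extb x U S : (x * extb K U) S =
  if U \subset S then (-1) ^+ shuffle_inv (S :\: U) U * (x (S :\: U) : K) else 0.
Proof.
rewrite extE ffunE; have [US|nUS] := ifPn.
  rewrite (bigD1 (S :\: U)) ?subsetDl //= big1 ?addr0 => [|A /andP[AS ne]].
    by rewrite ffunE setDDr setDv set0U (setIidPr US) eqxx mulr1.
  rewrite ffunE; case: eqP => [E|]; rewrite ?mulr0 //.
  by rewrite -E setDDr setDv set0U (setIidPr AS) eqxx in ne.
rewrite big1 // => A AS; rewrite ffunE; case: eqP => [E|]; rewrite ?mulr0 //.
by rewrite -E subsetDl in nUS.
Qed.

(* An ideal when Q is upward closed. *)
Definition monomial_span Q x : Prop := forall S, x S != 0 -> Q S.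

Lemma eq_monomial_span Q Q' x :
  Q =1 Q' -> monomial_span Q x <-> monomial_span Q' x.
Proof. by move=> eQ; split=> H S /H; rewrite eQ. Qed.

(** Multiplication by [extb K U] kills the monomials meeting [U] and sends the others, up to sign,
    to distinct monomials, so no cancellation occurs. *)
Lemma monomial_span_colon Q U v : monomial_span Q (v * extb K U) <->
  monomial_span (fun S => ~~ [disjoint S & U] || Q (S :|: U)) v.
Proof.
split=> H S.
  move=> vS; case: (boolP [disjoint S & U]) => //= dSU; apply: H.
  rewrite ext_mul_extb subsetUr setDUl setDv setU0 (setDidPl _) //.
  by rewrite mulf_neq0 // signr_eq0.
rewrite ext_mul_extb; have [US|_] := ifPn; last by rewrite eqxx.
rewrite mulf_eq0 signr_eq0 => /H; rewrite setDUK //.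
by rewrite -setI_eq0 setIDAC setDIl setDv setI0 eqxx.
Qed.

Lemma monomial_span_add Q U x :
  monomial_span (fun S => Q S || (U \subset S)) x <->
  exists2 x', monomial_span Q x' & exists v, x = x' + v * extb K U.
Proof.
split=> [H|[x' Hx' [v ->]] S]; last first.
  rewrite ffunE ext_mul_extb; case: (U \subset S); rewrite ?orbT // addr0 orbF.
  exact: Hx'.
exists ([ffun S => if Q S then x S else 0] : ext K n).
  by move=> S; rewrite ffunE; case: ifP; rewrite ?eqxx.
(* Monomials in [Q] are already accounted for; the others are divided by [extb K U], undoing the
   shuffle sign. *)
exists ([ffun S => if Q (S :|: U) then 0 else (-1) ^+ shuffle_inv S U * (x (S :|: U) : K)]
  : ext K n).
apply/ffunP => S; rewrite ffunE ext_mul_extb !ffunE.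
have [US|nUS] := boolP (U \subset S).
  rewrite setDUK //; case: ifP => QS; first by rewrite mulr0 addr0.
  by rewrite signrMK add0r.
rewrite addr0; case: ifP => // QS; apply/eqP; apply: contraTT isT => /H.
by rewrite QS (negPf nUS).
Qed.

End MonomialIdeals.

Section CartanResolution.
Variables (K : fieldType) (n : nat).
Implicit Types (l : seq 'I_n) (a : 'I_n).

(* The number of monomials of degree i in divided powers of the variables in l. *)
Fixpoint cartan_rank (i : nat) : seq 'I_n -> nat :=
  match i with
  | 0 => fun _ => 1%N
  | i'.+1 => fix rank l := if l is _ :: l' then (rank l' + cartan_rank i' l)%N else 0%N
  end.

(** The connecting map of the cone. A multiple [a u] has an [e_a]-term at [u]; if [u] itself
    contains [a], that term already comes from the block of multiples of [a]. *)
Definition cartan_htpy i a l :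
    'M[ext K n]_(cartan_rank i.+1 (a :: l), cartan_rank i.+1 l) :=
  col_mx (extb K [set a])%:M (0 : 'M_(cartan_rank i (a :: l), _)).

(* The monomials in a :: l of degree i.+1 are those in l together with the
   multiples of the variable a. *)
Fixpoint cartan_dif (i : nat) :
    forall l, 'M[ext K n]_(cartan_rank i.+1 l, cartan_rank i l) :=
  match i return forall l, 'M[ext K n]_(cartan_rank i.+1 l, cartan_rank i l) with
  | 0 => fix dif l := match l return 'M[ext K n]_(cartan_rank 1 l, 1) with
      | [::] => 0
      | a :: l' => col_mx (dif l') (extb K [set a])%:M
      end
  | i'.+1 => fix dif l :=
      match l return 'M[ext K n]_(cartan_rank i'.+2 l, cartan_rank i'.+1 l) with
      | [::] => 0
      | a :: l' => block_mx (dif l') 0 (cartan_htpy i' a l') (cartan_dif i' (a :: l'))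
      end
  end.

(** The rank counts multisets, and its recursion is Pascal's rule. *)
Lemma cartan_rankE i l : cartan_rank i l = 'C((size l + i).-1, i).
Proof.
elim: i l => [|i IHi] l; first by rewrite bin0.
elim: l => [|a l IHl]; first by rewrite /= bin_small.
have -> : cartan_rank i.+1 (a :: l) = (cartan_rank i.+1 l + cartan_rank i (a :: l))%N by [].
by rewrite IHl IHi /= !addnS /= binS.
Qed.

Lemma cartan_dif_homogeneous i l : mx_homogeneous 1 (cartan_dif i l).
Proof.
have hom a : homogeneous 1 (extb K [set a]).
  by have := @homogeneous_extb K n [set a]; rewrite cards1.
elim: i l => [|i IHi]; elim=> [|a l IHl] /=; try exact: mx_homogeneous0.
  by apply: mx_homogeneous_col; [exact: IHl | exact: mx_homogeneous_scalar].
apply: mx_homogeneous_block; [exact: IHl | exact: mx_homogeneous0 | | exact: (IHi (a :: l))].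
apply: mx_homogeneous_col; last exact: mx_homogeneous0.
exact: mx_homogeneous_scalar.
Qed.

Lemma cartan_dif_anticomm i l a :
  (extb K [set a])%:M *m cartan_dif i l + cartan_dif i l *m (extb K [set a])%:M = 0.
Proof.
apply/matrixP => k j; rewrite mxE mulmx_scalarE mul_scalar_mx !mxE.
by rewrite homogeneous1_anticomm ?addNr //; apply: cartan_dif_homogeneous.
Qed.

Lemma cartan_aug l (x : ext K n) :
  monomial_span (fun S => ~~ [disjoint S & l]) x <->
  exists v : 'rV_(cartan_rank 1 l), v *m cartan_dif 0 l = x%:M.
Proof.
elim: l x => [|a l IHl] x.
  split=> [H|[v]]; last first.
    rewrite mulmx0 => /matrixP/(_ 0 0); rewrite !mxE eqxx mulr1n => <- S.
    by rewrite ffunE eqxx.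
  exists 0; rewrite mulmx0; suff -> : x = 0 by rewrite raddf0.
  apply/ffunP => S; rewrite ffunE; apply/eqP; apply: contraTT isT => /H.
  by rewrite disjoint_sym disjoint_has.
have E : monomial_span (fun S => ~~ [disjoint S & a :: l]) x <->
    monomial_span (fun S => ~~ [disjoint S & l] || ([set a] \subset S)) x.
  apply: eq_monomial_span => S; rewrite sub1set [in LHS]disjoint_sym.
  by rewrite disjoint_cons negb_and negbK orbC [in LHS]disjoint_sym.
split=> [/E/monomial_span_add [x' /IHl [w Ew] [v ->]]|[w]].
  exists (row_mx w v%:M); rewrite mul_row_col Ew -scalar_mxM.
  by rewrite -raddfD.
rewrite -[w]hsubmxK mul_row_col => Ew.
apply/E/monomial_span_add; exists ((lsubmx w *m cartan_dif 0 l) 0 0).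
  apply/IHl; exists (lsubmx w).
  by apply/matrixP => i j; rewrite [RHS]mxE !ord1 eqxx mulr1n.
exists (rsubmx w 0 0); move/matrixP/(_ 0 0): Ew; rewrite [RHS]mxE eqxx mulr1n => <-.
by rewrite mxE mulmx_scalarE.
Qed.

(** Follows from [e_a e_a = 0] and from [e_a] anticommuting with the linear entries of the
    differential. *)
Lemma cartan_htpy_rel i a l :
  cartan_htpy i.+1 a l *m cartan_dif i.+1 l +
  cartan_dif i.+1 (a :: l) *m cartan_htpy i a l = 0.
Proof.
pose e : ext K n := extb K [set a].
have -> : cartan_htpy i.+1 a l *m cartan_dif i.+1 l =
    col_mx (e%:M *m cartan_dif i.+1 l) 0 by rewrite mul_col_mx mul0mx.
have -> : cartan_dif i.+1 (a :: l) *m cartan_htpy i a l =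
    col_mx (cartan_dif i.+1 l *m e%:M) 0.
  rewrite mul_block_col !mulmx0 !addr0 mul_col_mx mul0mx.
  by rewrite -scalar_mxM extb_sq raddf0 col_mx0.
rewrite add_col_mx addr0 -[RHS]col_mx0; congr col_mx; exact: (cartan_dif_anticomm i.+1 l a).
Qed.

(** The complex of [a :: l] is the cone of a map from its own shift to the complex of [l], whence
    the double induction. The bottom case rests on the colon of [(l)] by [e_a] being [(a, l)]. *)
Lemma cartan_exact i l :
  uniq l -> exact_at (cartan_dif i.+1 l) (cartan_dif i l).
Proof.
elim: l i => [|a l IHl] i.
  move=> _ v; split=> [_|_]; last by rewrite (thinmx0 v) mul0mx.
  by exists 0; rewrite (thinmx0 v) mul0mx.
case/andP => al ul; elim: i => [|i IHi]; last first.
  exact: (cone_exact (IHl _ ul) IHi (cartan_htpy_rel i a l)).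
apply: (@cone_exact_aug _ _ _ _ _ _ (cartan_dif 1 l) (cartan_dif 0 l)
  (cartan_dif 0 (a :: l)) (cartan_htpy 0 a l) (extb K [set a])%:M (IHl _ ul)).
  pose e : ext K n := extb K [set a].
  have -> : cartan_htpy 0 a l *m cartan_dif 0 l =
    col_mx (e%:M *m cartan_dif 0 l) 0 by rewrite mul_col_mx mul0mx.
  have -> : cartan_dif 0 (a :: l) *m e%:M = col_mx (cartan_dif 0 l *m e%:M) 0.
    by rewrite mul_col_mx -scalar_mxM extb_sq raddf0.
  rewrite add_col_mx addr0 -[RHS]col_mx0; congr col_mx; exact: (cartan_dif_anticomm 0 l a).
move=> v [u Eu].
have /cartan_aug [w Ew] : monomial_span (fun S => ~~ [disjoint S & a :: l]) (v 0 0).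
  have : monomial_span (fun S => ~~ [disjoint S & l]) (v 0 0 * extb K [set a]).
    apply/cartan_aug; exists u; rewrite -Eu.
    by apply/matrixP => i j; rewrite !ord1 mulmx_scalarE [RHS]mxE eqxx.
  (* If [S] avoids [a :: l], then adjoining [a] does not make it meet [l], because [a] is not in
     [l]. *)
  move/monomial_span_colon => H S /H; apply: contraLR; rewrite negbK negb_or !negbK => dS.
  have /andP[aS dlS] : (a \notin S) && [disjoint l & S].
    by rewrite -disjoint_cons disjoint_sym.
  rewrite disjoint_sym disjoints1 aS disjoint_sym disjoint_has; apply/hasPn => i il.
  rewrite !inE (disjointFr dlS il) orFb; by apply: contraNneq al => <-.
exists w; rewrite -[_ *m _]/(w *m cartan_dif 0 (a :: l)) Ew.
by apply/matrixP => i j; rewrite !ord1 [RHS]mxE eqxx.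
Qed.

(** The Cartan complex resolves [E] modulo the variables in [l]; dropping its first term gives the
    ideal, whence the index shift. *)
Lemma cartan_linear_res l : uniq l ->
  has_linear_res 1 (@monomial_span K n (fun S => ~~ [disjoint S & l]))
    (fun i => cartan_rank i.+1 l).
Proof.
move=> ul; exists (@GradedFree K n (fun i => cartan_rank i.+1 l)
  (fun i _ => (1 + i)%:Z) (cartan_dif 0 l) (fun i => cartan_dif i.+1 l)).
split=> //; split=> /=.
- by move=> k; apply: (@cartan_dif_homogeneous 0 l).
- move=> i k j; rewrite addnS -addn1 PoszD addrAC subrr add0r.
  exact: (@cartan_dif_homogeneous i.+1 l).
- exact: cartan_aug.
- exact: (@cartan_exact 0 l ul).
- by move=> i; apply: (@cartan_exact i.+1 l ul).
Qed.

End CartanResolution.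

(** * Powers of a linear monomial ideal *)

(** For [m <= q] both sides are the multinomial coefficient [(q + i)!] over [m! i! (q - m)!]. *)
Lemma bin_shift q m i :
  ('C(q + i, m + i) * 'C(m + i, i) = 'C(q, m) * 'C(q + i, i))%N.
Proof.
have [lt_qm|le_mq] := ltnP q m; first by rewrite (@bin_small (q + i)) ?ltn_add2r // (bin_small lt_qm).
apply/eqP; rewrite -(eqn_pmul2r (fact_gt0 i)) -(eqn_pmul2r (fact_gt0 m)).
rewrite -(eqn_pmul2r (fact_gt0 (q - m))); apply/eqP.
have E1 := @bin_fact (q + i) (m + i); rewrite leq_add2r le_mq subnDr in E1.
have E2 := @bin_fact (m + i) i; rewrite leq_addl addnK in E2.
have E3 := bin_fact le_mq.
have E4 := @bin_fact (q + i) i; rewrite leq_addl addnK in E4.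
transitivity ((q + i)`!); last rewrite -(E4 isT) -E3.
  by rewrite -(E1 isT) -(E2 isT) !mulnA; congr (_ * _)%N; rewrite -!mulnA.
by rewrite -!mulnA [RHS]mulnCA; congr (_ * _)%N; rewrite mulnCA; congr (_ * _)%N.
Qed.

Section PowerResolution.
Variables (K : fieldType) (n : nat).
Implicit Types (S W : {set 'I_n}) (l : seq 'I_n) (a : 'I_n).

Lemma zero_linear_res m : has_linear_res m (fun x : ext K n => x = 0) (fun _ => 0%N).
Proof.
exists (@GradedFree K n (fun _ => 0%N) (fun i _ => (m + i)%:Z) 0 (fun _ => 0)).
split=> //; split=> /=.
- by case.
- by move=> ? [].
- move=> x; split=> [->|[v]]; first by exists 0; rewrite mulmx0 raddf0.
  by rewrite mulmx0 => /matrixP/(_ 0 0); rewrite !mxE eqxx mulr1n.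
- move=> v; rewrite mulmx0; split=> // _; by exists 0; rewrite mulmx0 (thinmx0 v).
- move=> i v; rewrite mulmx0; split=> // _; by exists 0; rewrite mulmx0 (thinmx0 v).
Qed.

Definition level l S := #|[set i in S | i \in l]|.

Lemma level_cons a l S : a \notin l -> level (a :: l) S = ((a \in S) + level l S)%N.
Proof.
move=> al; rewrite /level (cardsD1 a) !inE eqxx andbT; congr (_ + _)%N.
apply: eq_card => i; rewrite !inE; case: eqP => //= ->.
by rewrite (negPf al) andbF.
Qed.

Lemma exists_subset (T : finType) (A : {set T}) k :
  (k <= #|A|)%N -> exists2 B : {set T}, B \subset A & #|B| = k.
Proof.
rewrite -bin_gt0 -cards_draws card_gt0 => /set0Pn [B].
by rewrite inE => /andP[BA /eqP]; exists B.
Qed.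

(** Each [e_a e_W] adds a cone over the Cartan complex of [a :: l]. Indeed [a] and the variables of
    [W] kill it, and a variable in [l] outside [W] raises its level to [m + 1]. A multiple by a
    monomial avoiding [a :: l] meets [l] exactly in [W], so no other [V] of the same size can divide
    it. *)
Lemma power_linear_res_step m a l (ws : seq {set 'I_n}) (r : nat -> nat) :
  a \notin l -> uniq l -> uniq ws ->
  {in ws, forall W, W \subset [set i in l] /\ #|W| = m} ->
  has_linear_res m.+1 (@monomial_span K n (fun S => m < level l S)%N) r ->
  has_linear_res m.+1 (@monomial_span K n (fun S =>
      (m < level l S)%N || has (fun W => a |: W \subset S) ws))
    (fun i => r i + size ws * cartan_rank i (a :: l))%N.
Proof.
move=> al ul + + res_l; elim: ws => [|W ws IH] /=.
  move=> _ _; apply: eq_linear_res res_l => [x|i].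
    by apply: eq_monomial_span => S; rewrite orbF.
  by rewrite mul0n addn0.
case/andP => W_ws u_ws szW; have [Wl cW] := szW W (mem_head _ _).
have {}IH := IH u_ws (fun V Vws => szW V (mem_behead (s := W :: ws) Vws)).
have ual : uniq (a :: l) by rewrite /= al.
have aW : a \notin W by apply: contra al => /(subsetP Wl); rewrite inE.
have haW : homogeneous m.+1%:Z (extb K (a |: W)).
  by have := @homogeneous_extb K n (a |: W); rewrite cardsU1 aW cW.
apply: (eq_linear_res _ _ (linear_res_cone IH (cartan_linear_res K ual) haW _)).
- move=> x; apply: (iff_trans (iff_sym (monomial_span_add _ _ _))).
  by apply: eq_monomial_span => S; rewrite -orbA [has _ _ || _]orbC.
- by case=> [|i]; rewrite mulSn -addnA [(_ * _ + _)%N]addnC.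
- move=> v; apply: (iff_trans (monomial_span_colon _ _ _)).
  apply: eq_monomial_span => S.
  have symS : [disjoint S & a :: l] = [disjoint a :: l & S] by rewrite disjoint_sym.
  apply/idP/idP; last first.
    rewrite symS disjoint_has negbK => /hasP [t tal tS].
    have [dS|//] := boolP [disjoint S & a |: W]; rewrite orFb.
    have ta : t \notin a |: W by rewrite (disjointFr dS tS).
    have tl : t \in l.
      by move: tal; rewrite inE => /orP[/eqP ta'|//]; rewrite ta' setU11 in ta.
    apply/orP; left; rewrite -cW; apply: leq_trans (_ : #|t |: W| <= _)%N.
      have tW : t \notin W by apply: contra ta => tW; rewrite !inE tW orbT.
      by rewrite cardsU1 tW.
    apply: subset_leq_card; apply/subsetP => i; rewrite !inE.
    case/orP=> [/eqP ->|iW]; first by rewrite tS tl.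
    by rewrite iW !orbT /=; have := subsetP Wl _ iW; rewrite inE.
  apply: contraLR; rewrite negbK negb_or negbK => dS.
  have /andP[aS dlS] : (a \notin S) && [disjoint l & S].
    by rewrite -disjoint_cons disjoint_sym.
  have lvl : [set i in S :|: (a |: W) | i \in l] = W.
    apply/setP => i; rewrite !inE; have [il|nil] := boolP (i \in l).
      rewrite (disjointFr dlS il) andbT /=; case: eqP => // ia.
      by rewrite -ia il in al.
    by rewrite andbF; apply/esym/negbTE; apply: contra nil => /(subsetP Wl); rewrite inE.
  apply/andP; split.
    rewrite disjoint_sym disjoint_subset; apply/subsetP => i; rewrite !inE.
    case/orP=> [/eqP -> //|/(subsetP Wl)]; rewrite inE => il.
    by rewrite (disjointFr dlS il).
  rewrite negb_or /level lvl cW ltnn /=; apply/hasPn => V Vws.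
  apply: contra W_ws => aVS; have [Vl cV] := szW V (mem_behead (s := W :: ws) Vws).
  suff <- : V = W by [].
  apply/eqP; rewrite eqEcard cV cW leqnn andbT -lvl.
  apply/subsetP => i iV; rewrite inE; apply/andP; split.
    by apply: (subsetP aVS); rewrite !inE iV orbT.
  by have := subsetP Vl _ iV; rewrite inE.
Qed.

(** Induction on [l]: a monomial with more than [m] indices in [a :: l] either has that many in [l]
    or is divisible by some [e_a e_W] with [W] an [m]-subset of [l]. *)
Lemma power_linear_resS m l : uniq l ->
  has_linear_res m.+1 (@monomial_span K n (fun S => m < level l S)%N)
    (fun i => 'C(size l + i, m.+1 + i) * 'C(m + i, i))%N.
Proof.
elim: l => [|a l IH] => [_|/andP[al ul]].
  apply: (eq_linear_res _ _ (zero_linear_res m.+1)) => [x|i]; last first.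
    by rewrite [size _]/= (@bin_small (0 + i)) // addSn ltnS leq_addl.
  split=> [-> S|H]; first by rewrite ffunE eqxx.
  apply/ffunP => S; rewrite ffunE; apply/eqP; apply: contraTT isT => /H.
  by rewrite /level eq_card0 // => i; rewrite !inE andbF.
pose ws := enum [set W : {set 'I_n} | (W \subset [set i in l]) & (#|W| == m)].
have cl : #|[set i in l]| = size l by rewrite cardsE; apply/card_uniqP.
have sz : size ws = 'C(size l, m) by rewrite -cardE cards_draws cl.
have Hws : {in ws, forall W, W \subset [set i in l] /\ #|W| = m}.
  by move=> W; rewrite mem_enum inE => /andP[Wl /eqP].
have := power_linear_res_step al ul (enum_uniq _) Hws (IH ul).
apply: eq_linear_res => [x|i]; last first.
  (* The first Pascal summand is the rank for [l]; [bin_shift] identifies the second with the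
     ['C(size l, m)] new Cartan complexes. *)
  rewrite sz cartan_rankE /= !addSn /= [in RHS]binS mulnDl; congr (_ + _)%N.
  by rewrite bin_shift.
apply: eq_monomial_span => S; rewrite level_cons //; apply/idP/idP.
  case/orP=> [h|/hasP [W Wws aWS]]; first exact: ltn_addl.
  have [Wl <-] := Hws W Wws.
  rewrite (subsetP aWS) ?setU11 // add1n ltnS; apply: subset_leq_card.
  apply/subsetP => i iW; rewrite inE (subsetP aWS) ?inE ?iW ?orbT //=.
  by have := subsetP Wl _ iW; rewrite inE.
have [aS|aS] := boolP (a \in S); last by rewrite add0n => ->.
rewrite add1n ltnS => /exists_subset [W WS cW].
have WSP := subsetP WS.
apply/orP; right; apply/hasP; exists W.
  rewrite mem_enum inE cW eqxx andbT; apply/subsetP => i /WSP.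
  by rewrite !inE => /andP[].
rewrite subUset sub1set aS /=; apply/subsetP => i /WSP.
by rewrite !inE => /andP[].
Qed.

(** For [m = 0] the ideal is all of [E], obtained as a cone over the zero ideal with generator 1.
    The predecessor then makes the formula 1 at [i = 0] and 0 beyond. *)
Lemma power_linear_res m l : uniq l ->
  has_linear_res m (@monomial_span K n (fun S => m <= level l S)%N)
    (fun i => 'C(size l + i, m + i) * 'C((m + i).-1, i))%N.
Proof.
case: m => [|m] ul; last exact: power_linear_resS.
have colon (v : ext K n) : v * 1 = 0 <-> monomial_span (fun S => ~~ [disjoint S & [::]]) v.
  rewrite mulr1; split=> [-> S|H]; first by rewrite ffunE eqxx.
  apply/ffunP => S; rewrite ffunE; apply/eqP; apply: contraTT isT => /H.
  by rewrite disjoint_sym disjoint_has.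
have h1 : homogeneous 0 (1 : ext K n).
  by have := @homogeneous_extb K n set0; rewrite cards0.
apply: (eq_linear_res _ _ (linear_res_cone (zero_linear_res 0)
  (cartan_linear_res K (erefl : uniq [::])) h1 colon)) => [x|[|i]].
- by split=> // _; exists 0 => //; exists x; rewrite mulr1 add0r.
- by rewrite !bin0.
- by rewrite (@bin_small i) // muln0.
Qed.

End PowerResolution.

(** * The boundary operator *)

Section Generators.
Variables (K : fieldType) (n : nat).
Implicit Types (x y : ext K n) (S B C : {set 'I_n}) (i j b : 'I_n).
Local Notation e i := (extb K [set i]).

Lemma extb_cons b C :
  (forall c, c \in C -> (b < c)%N) -> e b * extb K C = extb K (b |: C).
Proof.
move=> bC; rewrite extb_mul disjoints1.
have -> : b \notin C by apply/negP => /bC; rewrite ltnn.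
rewrite /shuffle_inv big_set1 big1 ?scale1r // => c /bC bc.
by rewrite ltnNge ltnW.
Qed.

Lemma enum_cons b C : (forall c, c \in C -> (b < c)%N) -> enum (b |: C) = b :: enum C.
Proof.
move=> bC.
have sE S : sorted (relpre val ltn) (enum S).
  rewrite {1}/enum_mem; apply: sorted_filter; first by move=> ? ? ?; apply: ltn_trans.
  by rewrite -sorted_map -enumT val_enum_ord iota_ltn_sorted.
apply: (irr_sorted_eq (leT := relpre val ltn)) => //.
- by move=> ? ? ?; apply: ltn_trans.
- by move=> i /=; rewrite ltnn.
- rewrite /= (path_sortedE (fun _ _ _ => @ltn_trans _ _ _)) sE andbT.
  by apply/allP => c; rewrite mem_enum => /bC.
- by move=> i; rewrite inE !mem_enum !inE.
Qed.

Lemma set_min S : S != set0 ->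
  exists b, exists2 C, S = b |: C & forall c, c \in C -> (b < c)%N.
Proof.
case/set0Pn => s sS; case: (arg_minnP (fun i : 'I_n => i : nat) sS) => b bS bmin.
exists b, (S :\ b); first by rewrite setD1K.
move=> c /setD1P [cb cS]; rewrite ltn_neqAle bmin // andbT.
by apply: contraNneq cb => /val_inj ->.
Qed.

(* Anticommuting operators T i of square zero make M a module over the exterior
   algebra; a map that respects left multiplication by e_b on the monomials all
   of whose indices exceed b is a module homomorphism. *)
Lemma anticommuting_operators (M : lmodType K) (Phi : ext K n -> M)
    (T : 'I_n -> M -> M) :
  scalable Phi -> (forall i, scalable (T i)) ->
  (forall i z, T i (T i z) = 0) -> (forall i j z, T i (T j z) = - T j (T i z)) ->
  (forall b C, (forall c, c \in C -> (b < c)%N) ->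
     Phi (extb K (b |: C)) = T b (Phi (extb K C))) ->
  forall i B, Phi (e i * extb K B) = T i (Phi (extb K B)).
Proof.
move=> PhiZ TZ Tsq TC Phi_cons i B; move: {2}#|B| (leqnn #|B|) => k.
elim: k B i => [|k IH] B i; have [-> _|/set_min [b [C -> bC]]] := eqVneq B set0.
- by rewrite mulr1 -[in LHS](setU0 [set i]) Phi_cons // => c; rewrite inE.
- by rewrite cardsU1 (contra (bC b)) ?ltnn.
- by rewrite mulr1 -[in LHS](setU0 [set i]) Phi_cons // => c; rewrite inE.
have Phi0 : Phi 0 = 0 by have := PhiZ 0 0; rewrite !scale0r.
have T0 j : T j 0 = 0 by have := TZ j 0 0; rewrite !scale0r.
have PhiN x : Phi (- x) = - Phi x by have := PhiZ (-1) x; rewrite !scaleN1r.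
have bnC : b \notin C by apply/negP => /bC; rewrite ltnn.
rewrite cardsU1 bnC add1n ltnS => cC; rewrite Phi_cons // -extb_cons // mulrA.
(* Compare [i] with the least index [b]: if equal, both sides vanish; if [i] is larger, it is moved
   past [b] and the induction applies to [C]; if smaller, it becomes the new least index. *)
have [ib|bi|/val_inj ->] := ltngtP i b; last first.
- by rewrite extb_sq mul0r Phi0 Tsq.
- rewrite extb_anticomm mulNr PhiN -mulrA TC -IH //; congr (- _).
  have [iC|niC] := boolP (i \in C).
    by rewrite extb_mul disjoints1 iC /= mulr0 Phi0 T0.
  rewrite extb_mul disjoints1 niC -scalerAr !PhiZ TZ.
  have biC c : c \in i |: C -> (b < c)%N by case/setU1P => [->|/bC].
  by rewrite extb_cons // Phi_cons.
rewrite -mulrA extb_cons // extb_cons ?Phi_cons //.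
- by move=> c /setU1P [->|/bC bc] //; apply: ltn_trans bc.
- by move=> c /setU1P [->|/bC bc] //; apply: ltn_trans bc.
Qed.

End Generators.

(** * The boundary of a monomial as a product of linear forms *)

Section BoundaryProduct.
Variables (K : fieldType) (n : nat).
Implicit Types (x y : ext K n) (S B C : {set 'I_n}) (i j s b : 'I_n).
Local Notation e i := (extb K [set i]).

Definition ext_boundary x : ext K n := \sum_(S : {set 'I_n}) x S *: boundary K S.

Lemma ext_boundary_linear : linear ext_boundary.
Proof.
move=> c x y; rewrite /ext_boundary scaler_sumr -big_split; apply: eq_bigr => S _.
by rewrite !ffunE scalerDl scalerA.
Qed.

HB.instance Definition _ := GRing.isLinear.Build K (ext K n) (ext K n) *:%R
  ext_boundary ext_boundary_linear.

Lemma ext_boundary_extb S : ext_boundary (extb K S) = boundary K S.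
Proof.
rewrite /ext_boundary (bigD1 S) //= ffunE eqxx scale1r big1 ?addr0 // => T TS.
by rewrite ffunE (negPf TS) scale0r.
Qed.

Lemma boundary_cons b C : (forall c, c \in C -> (b < c)%N) ->
  boundary K (b |: C) = extb K C - e b * boundary K C.
Proof.
move=> bC; have bnC : b \notin C by apply/negP => /bC; rewrite ltnn.
rewrite /boundary big_setU1 //= setU1K //; congr (_ + _).
  rewrite (_ : [set i in _ | _] = set0) ?cards0 ?scale1r //.
  apply/setP => i; rewrite !inE; case: eqP => [->|_] /=; first by rewrite ltnn.
  by apply/negP => /andP[/bC bi]; rewrite ltnNge ltnW.
rewrite mulr_sumr -sumrN; apply: eq_bigr => j jC.
rewrite -scalerAr extb_cons => [|c /setD1P [_ /bC] //].
rewrite -scaleNr; congr (_ *: _).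
  rewrite (cardsD1 b) !inE eqxx bC //= exprS mulN1r; congr (- _ ^+ _).
  apply: eq_card => i; rewrite !inE; case: eqP => //= ->.
  by rewrite (negPf bnC).
congr (extb K _); apply/setP => i; rewrite !inE; case: eqP => //= ->.
by case: eqP => // jb; rewrite -jb jC in bnC.
Qed.

(** The operators [T i] describe the expected effect of multiplication by [e_i] on pairs of an
    element and its boundary. They anticommute and square to 0, so it suffices to adjoin a new least
    index, which is [boundary_cons]. *)
Lemma ext_boundaryM i x : ext_boundary (e i * x) = x - e i * ext_boundary x.
Proof.
pose T i (z : ext K n * ext K n) := (e i * z.1, z.1 - e i * z.2).
have opE B : (e i * extb K B, ext_boundary (e i * extb K B)) =
    T i (extb K B, ext_boundary (extb K B)).
  apply: (@anticommuting_operators K n _ (fun x => (x, ext_boundary x)) T).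
  - by move=> c z; rewrite linearZ.
  - by move=> j c z; rewrite /T /= -!scalerAr -scalerBr.
  - by move=> j z; rewrite /T /= mulrBr !mulrA !extb_sq !mul0r subr0 subrr.
  - move=> j k z; rewrite /T /= !mulrBr !mulrA [e j * e k]extb_anticomm !mulNr.
    by apply: injective_projections => //=; rewrite !opprB addrA.
  - by move=> b C bC; rewrite /T /= -extb_cons // extb_cons // !ext_boundary_extb boundary_cons.
have -> : ext_boundary (e i * x) =
    \sum_(B : {set 'I_n}) x B *: ext_boundary (e i * extb K B).
  rewrite {1}[x]ext_sumE mulr_sumr raddf_sum; apply: eq_bigr => B _.
  by rewrite -scalerAr /= linearZ.
rewrite {2}[x]ext_sumE [in RHS]/ext_boundary mulr_sumr -sumrB; apply: eq_bigr => B _.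
rewrite -!scalerAr -scalerBr; congr (_ *: _).
by case: (opE B) => ->; rewrite ext_boundary_extb.
Qed.

(** By [ext_boundaryM], the right-hand side is the boundary of [e_s] times the product of the
    [e_i]. *)
Lemma prod_sub_extb s (l : seq 'I_n) :
  \prod_(i <- l) (e i - e s) =
  \prod_(i <- l) e i - e s * ext_boundary (\prod_(i <- l) e i).
Proof.
elim: l => [|i l IH].
  by rewrite !big_nil ext_boundary_extb /boundary big_set0 mulr0 subr0.
rewrite !big_cons IH ext_boundaryM mulrBl !mulrBr !mulrA extb_sq mul0r subr0.
by rewrite [e i * e s]extb_anticomm mulNr opprK opprB addrA.
Qed.

Lemma boundary_prod s S : s \in S -> exists2 c : K, c != 0 &
  boundary K S = c *: \prod_(i <- enum (S :\ s)) (e i - e s).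
Proof.
(* The sign of moving [e_s] to the front of [e_S]. *)
move=> sS; exists ((-1) ^+ shuffle_inv [set s] (S :\ s)).
  by rewrite signr_eq0.
rewrite prod_sub_extb -extb_prod -ext_boundaryM extb_mul disjoints1.
rewrite !inE eqxx /= setD1K // linearZ /= scalerA -expr2 sqrr_sign.
by rewrite scale1r ext_boundary_extb.
Qed.

End BoundaryProduct.

(** * Changes of variables *)

Section ExtMap.
Variables (K : fieldType) (n : nat).
Implicit Types (x y : ext K n) (S B C : {set 'I_n}) (i j : 'I_n) (A : 'M[K]_n).
Local Notation e i := (extb K [set i]).

Definition ext_lin (v : 'rV[K]_n) : ext K n := \sum_j v 0 j *: e j.

Lemma ext_lin_linear : linear ext_lin.
Proof.
move=> c u v; rewrite /ext_lin scaler_sumr -big_split; apply: eq_bigr => j _.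
by rewrite !mxE scalerDl scalerA.
Qed.

HB.instance Definition _ := GRing.isLinear.Build K 'rV[K]_n (ext K n) *:%R
  ext_lin ext_lin_linear.

Lemma ext_lin_delta j : ext_lin (delta_mx 0 j) = e j.
Proof.
rewrite /ext_lin (bigD1 j) //= mxE !eqxx scale1r big1 ?addr0 // => k kj.
by rewrite mxE (negPf kj) andbF scale0r.
Qed.

Lemma ext_lin_homogeneous v : homogeneous 1 (ext_lin v).
Proof.
apply: homogeneous_sum => j _; apply: homogeneousZ.
by have := @homogeneous_extb K n [set j]; rewrite cards1.
Qed.

Lemma ext_lin_anticomm u v : ext_lin u * ext_lin v = - (ext_lin v * ext_lin u).
Proof.
rewrite {1 3}/ext_lin mulr_suml mulr_sumr -sumrN; apply: eq_bigr => j _.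
rewrite -scalerAl -scalerAr homogeneous1_anticomm ?scalerN //.
exact: ext_lin_homogeneous.
Qed.

(* Anticommutativity does not give u * u = 0 in characteristic 2. *)
Lemma ext_lin_sq v : ext_lin v * ext_lin v = 0.
Proof.
rewrite /ext_lin; elim: (index_enum _) => [|i s IH]; first by rewrite big_nil mul0r.
rewrite big_cons mulrDl !mulrDr IH addr0 -scalerAl -scalerAr extb_sq !scaler0 add0r.
rewrite -scalerAl homogeneous1_anticomm ?scalerN -?scalerAr ?addNr //.
by apply: homogeneous_sum => j _; apply: homogeneousZ;
  have := @homogeneous_extb K n [set j]; rewrite cards1.
Qed.

(** The algebra endomorphism substituting for [e_i] the linear form with coefficients in row [i] of
    [A]. *)
Definition ext_map A x : ext K n :=
  \sum_(S : {set 'I_n}) x S *: \prod_(i <- enum S) ext_lin (row i A).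

Lemma ext_map_linear A : linear (ext_map A).
Proof.
move=> c x y; rewrite /ext_map scaler_sumr -big_split; apply: eq_bigr => S _.
by rewrite !ffunE scalerDl scalerA.
Qed.

HB.instance Definition _ A := GRing.isLinear.Build K (ext K n) (ext K n) *:%R
  (ext_map A) (ext_map_linear A).

Lemma ext_map_extb A S :
  ext_map A (extb K S) = \prod_(i <- enum S) ext_lin (row i A).
Proof.
rewrite /ext_map (bigD1 S) //= ffunE eqxx scale1r [X in _ + X]big1 ?addr0 // => T TS.
by rewrite ffunE (negPf TS) scale0r.
Qed.

(** Linear forms anticommute and square to 0, so [anticommuting_operators] applies to left
    multiplication by them. *)
Lemma ext_map_mul_gen A i x : ext_map A (e i * x) = ext_lin (row i A) * ext_map A x.
Proof.
have opE B : ext_map A (e i * extb K B) = ext_lin (row i A) * ext_map A (extb K B).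
  apply: (@anticommuting_operators K n _ (ext_map A)
    (fun i => GRing.mul (ext_lin (row i A)))).
  - by move=> c z; rewrite linearZ.
  - by move=> j c z; rewrite scalerAr.
  - by move=> j z; rewrite mulrA ext_lin_sq mul0r.
  - by move=> j k z; rewrite !mulrA ext_lin_anticomm mulNr.
  - by move=> b C bC; rewrite !ext_map_extb enum_cons // big_cons.
have -> : ext_map A (e i * x) =
    \sum_(B : {set 'I_n}) x B *: ext_map A (e i * extb K B).
  rewrite {1}[x]ext_sumE mulr_sumr raddf_sum; apply: eq_bigr => B _.
  by rewrite -scalerAr /= linearZ.
rewrite [ext_map A x in RHS]/ext_map mulr_sumr; apply: eq_bigr => B _.
by rewrite -scalerAr opE ext_map_extb.
Qed.

Lemma ext_map_multiplicative A : monoid_morphism (ext_map A).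
Proof.
split=> [|x y].
  by rewrite ext_map_extb enum_set0 big_nil.
have opE B : ext_map A (extb K B * y) = ext_map A (extb K B) * ext_map A y.
  rewrite ext_map_extb extb_prod; elim: (enum B) => [|i s IH].
    by rewrite !big_nil !mul1r.
  by rewrite !big_cons -!mulrA ext_map_mul_gen IH.
have -> : ext_map A (x * y) =
    \sum_(B : {set 'I_n}) x B *: ext_map A (extb K B * y).
  rewrite {1}[x]ext_sumE mulr_suml raddf_sum; apply: eq_bigr => B _.
  by rewrite -scalerAl /= linearZ.
rewrite [ext_map A x in RHS]/ext_map mulr_suml; apply: eq_bigr => B _.
by rewrite -scalerAl opE ext_map_extb.
Qed.

HB.instance Definition _ A := GRing.isMonoidMorphism.Build (ext K n) (ext K n)
  (ext_map A) (ext_map_multiplicative A).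

Lemma ext_map_gen A i : ext_map A (e i) = ext_lin (row i A).
Proof. by rewrite ext_map_extb enum_set1 big_seq1. Qed.

Lemma ext_map_homogeneous A d x : homogeneous d x -> homogeneous d (ext_map A x).
Proof.
move=> hx; apply: homogeneous_sum => S _.
have [->|/hx <-] := eqVneq (x S) 0; first by rewrite scale0r; apply: homogeneous0.
apply: homogeneousZ; rewrite cardE; elim: (enum S) => [|i s IH].
  by rewrite big_nil; have := @homogeneous_extb K n set0; rewrite cards0.
by rewrite big_cons /= -add1n; apply: homogeneousM => //; apply: ext_lin_homogeneous.
Qed.

Lemma ext_mapK A A' : (forall i, ext_map A (ext_lin (row i A')) = e i) ->
  cancel (ext_map A') (ext_map A).
Proof.
move=> AA' x; rewrite [x in RHS]ext_sumE [ext_map A' x]/ext_map raddf_sum.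
apply: eq_bigr => S _; rewrite [LHS]linearZ /= rmorph_prod extb_prod.
by congr (_ *: _); apply: eq_bigr => i _; apply: AA'.
Qed.

End ExtMap.

Section Transport.
Variables (K : fieldType) (n : nat) (f g : {rmorphism ext K n -> ext K n}).
Hypotheses (fK : cancel f g) (gK : cancel g f).
Hypothesis f_homogeneous : forall d x, homogeneous d x -> homogeneous d (f x).

Lemma map_mx_inv (h k : ext K n -> ext K n) p q (X : 'M[ext K n]_(p, q)) :
  cancel h k -> map_mx k (map_mx h X) = X.
Proof. by move=> hk; apply/matrixP => i j; rewrite !mxE hk. Qed.

Lemma exact_at_map p q r (d1 : 'M[ext K n]_(p, q)) (d0 : 'M[ext K n]_(q, r)) :
  exact_at d1 d0 -> exact_at (map_mx f d1) (map_mx f d0).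
Proof.
move=> ex v; split=> [v0|[w ->]].
  have /ex [w Ew] : map_mx g v *m d0 = 0.
    by rewrite -(map_mx_inv d0 fK) -map_mxM v0 raddf0.
  by exists (map_mx f w); rewrite -map_mxM -Ew map_mx_inv.
by rewrite -mulmxA -map_mxM (exact_mul0 ex) raddf0 mulmx0.
Qed.

(** Applying the automorphism [f] to all entries is only semilinear, but it preserves exactness and
    degrees and carries the ideal to its image under [f]. *)
Lemma linear_res_map m J r :
  has_linear_res m J r -> has_linear_res m (fun x => J (g x)) r.
Proof.
move=> [F [[h1 h2 h3 h4 h5] dF rF]].
exists (@GradedFree K n (gf_rank F) (@gf_deg _ _ F) (map_mx f (gf_aug F))
  (fun i => map_mx f (gf_dif F i))).
split=> //; split=> /=.
- by move=> k; rewrite mxE; apply: f_homogeneous.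
- by move=> i k l; rewrite mxE; apply: f_homogeneous.
- move=> x; split=> [/h3 [w Ew]|[w Ew]]; last apply/h3.
    by exists (map_mx f w); rewrite -map_mxM Ew map_scalar_mx gK.
  exists (map_mx g w); rewrite -(map_mx_inv (gf_aug F) fK) -map_mxM Ew.
  by rewrite map_scalar_mx.
- exact: exact_at_map.
- by move=> i; apply: exact_at_map.
Qed.

End Transport.

(** * The Orlik-Solomon ideal as a power *)

Section IdealGen.
Variables (K : fieldType) (n : nat) (G : ext K n -> Prop).

Lemma ideal_gen0 : ideal_gen G 0.
Proof.
exists 0%N, (fun _ => 0), (fun _ => 0), (fun _ => 0).
by split; [case | rewrite big_ord0].
Qed.

Lemma ideal_genD x y : ideal_gen G x -> ideal_gen G y -> ideal_gen G (x + y).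
Proof.
move=> [p [a [g [b [Gg ->]]]]] [q [a' [g' [b' [Gg' ->]]]]].
pose glue (u : 'I_p -> ext K n) (v : 'I_q -> ext K n) (i : 'I_(p + q)) :=
  match split i with inl j => u j | inr j => v j end.
exists (p + q)%N, (glue a a'), (glue g g'), (glue b b'); split.
  by move=> i; rewrite /glue; case: (split i).
rewrite big_split_ord; congr (_ + _); apply: eq_bigr => i _.
  by rewrite /glue (unsplitK (inl i)).
by rewrite /glue (unsplitK (inr i)).
Qed.

Lemma ideal_gen_sum (I : Type) (s : seq I) (P : pred I) (f : I -> ext K n) :
  (forall i, P i -> ideal_gen G (f i)) -> ideal_gen G (\sum_(i <- s | P i) f i).
Proof.
move=> Gf; apply: big_ind => //; first exact: ideal_gen0.
exact: ideal_genD.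
Qed.

Lemma ideal_gen_mul a g b : G g -> ideal_gen G (a * g * b).
Proof.
move=> Gg; exists 1%N, (fun _ => a), (fun _ => g), (fun _ => b).
by split=> //; rewrite big_ord1.
Qed.

End IdealGen.

Section LevelFiltration.
Variables (K : fieldType) (n : nat) (l : seq 'I_n).
Implicit Types (x y : ext K n) (S : {set 'I_n}).
Local Notation V k := (@monomial_span K n (fun S => k <= level l S)%N).

Lemma level_spanD k x y : V k x -> V k y -> V k (x + y).
Proof.
move=> hx hy S; rewrite ffunE; have [x0|/hx //] := eqVneq (x S) 0.
by rewrite x0 add0r => /hy.
Qed.

Lemma level_spanZ k (c : K) x : V k x -> V k (c *: x).
Proof.
move=> hx S; rewrite ffunE => cx; apply: hx; apply: contraNneq cx => ->.
by rewrite scaler0.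
Qed.

Lemma level_span_extb k S : (k <= level l S)%N -> V k (extb K S).
Proof. by move=> kS T; rewrite ffunE; have [->|_] := eqVneq T S; rewrite ?eqxx. Qed.

(** The level is additive over the disjoint pieces [A] and [S :\: A] of a monomial of the
    product. *)
Lemma level_spanM j k x y : V j x -> V k y -> V (j + k)%N (x * y).
Proof.
move=> hx hy S /ext_mul_support [A [AS /hx jA /hy kA]].
apply: leq_trans (leq_add jA kA) _.
rewrite /level -[in leqRHS](cardsID A) leq_add //; apply: subset_leq_card;
  apply/subsetP => i; rewrite !inE => /andP[].
  by move=> iA ->; rewrite (subsetP AS) ?iA.
by move=> /andP[iA iS] il; rewrite iA iS il.
Qed.

Lemma level_span_prod (I : Type) (s : seq I) (f : I -> ext K n) (k : I -> nat) :
  (forall i, V (k i) (f i)) -> V (\sum_(i <- s) k i)%N (\prod_(i <- s) f i).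
Proof.
move=> hf; elim: s => [|i s IH]; first by rewrite !big_nil => S _.
by rewrite !big_cons; apply: level_spanM.
Qed.

Lemma level_span_leq j k x : (k <= j)%N -> V j x -> V k x.
Proof. by move=> kj hx S /hx; apply: leq_trans. Qed.

End LevelFiltration.

(** * Changing variables along a retraction of the ground set *)

Section Retraction.
Variables (K : fieldType) (n : nat) (rt : 'I_n -> 'I_n).
Hypothesis rt_idem : forall i, rt (rt i) = rt i.
Implicit Types (x : ext K n) (S T : {set 'I_n}) (i s : 'I_n).
Local Notation e i := (extb K [set i]).

Definition moved : {set 'I_n} := [set i | rt i != i].

(** Encodes the substitution of [e_i - e_(rt i)] for each moved [e_i], fixing the roots; [expand_mx]
    encodes the inverse, which turns these linear forms into variables. *)
Definition contract_mx : 'M[K]_n :=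
  \matrix_i (delta_mx 0 i - (i \in moved)%:R *: delta_mx 0 (rt i)).
Definition expand_mx : 'M[K]_n :=
  \matrix_i ((i \in moved)%:R *: delta_mx 0 i + delta_mx 0 (rt i)).

Lemma contract_mxE i : ext_lin (row i contract_mx) = e i - (i \in moved)%:R *: e (rt i).
Proof. by rewrite rowK raddfB /= linearZ /= !ext_lin_delta. Qed.

Lemma expand_mxE i : ext_lin (row i expand_mx) = (i \in moved)%:R *: e i + e (rt i).
Proof. by rewrite rowK raddfD /= linearZ /= !ext_lin_delta. Qed.

Lemma rt_moved i : rt i \in moved = false.
Proof. by rewrite inE rt_idem eqxx. Qed.

Lemma contractK : cancel (ext_map expand_mx) (ext_map contract_mx).
Proof.
apply: ext_mapK => i; rewrite expand_mxE raddfD /= linearZ /= !ext_map_gen !contract_mxE.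
rewrite rt_moved scale0r subr0; have [im|] := boolP (i \in moved).
  by rewrite !scale1r subrK.
by rewrite inE negbK scale0r add0r => /eqP ->.
Qed.

Lemma expandK : cancel (ext_map contract_mx) (ext_map expand_mx).
Proof.
apply: ext_mapK => i; rewrite contract_mxE raddfB /= linearZ /= !ext_map_gen !expand_mxE.
rewrite rt_moved scale0r add0r; have [im|] := boolP (i \in moved).
  by rewrite !scale1r rt_idem addrK.
by rewrite inE negbK !scale0r add0r subr0 => /eqP ->.
Qed.

(** The hypotheses fit both families: [G] is the ground set of a single uniform summand with any
    [m], or all indices with [m = 1]. *)
Variables (M : matroid n) (m : nat) (G : {set 'I_n}).
Hypothesis dependentE : forall S, S \notin indep M <->
  exists2 s, s \in S :&: G & (m <= #|[set i in S :\ s | rt i == rt s]|)%N.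
Hypothesis common_root : forall T, T \subset moved -> #|T| = m ->
  exists2 s, s \in G & rt s = s /\ {in T, forall i, rt i = s}.

(** By [boundary_prod], a generator is a product with at least [m] factors [e_i - e_s] where [i] and
    [s] share a root. Conversely, [m] moved variables with common root [s] contract to a multiple of
    the boundary of a dependent set. *)
Lemma orlik_solomon_power x : @orlik_solomon K n M x <->
  monomial_span (fun S => m <= level (enum moved) S)%N (ext_map expand_mx x).
Proof.
have inV i : i \in moved -> monomial_span (fun S => 1 <= level (enum moved) S)%N (e i).
  move=> im; apply: level_span_extb; rewrite card_gt0; apply/set0Pn; exists i.
  by rewrite !inE eqxx mem_enum.
split=> [[p [a [g [b [Gg ->]]]]]|Vx].
  rewrite raddf_sum; apply: (big_ind (fun y => monomial_span _ y)).
  - by move=> S; rewrite ffunE eqxx.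
  - exact: level_spanD.
  move=> j _; rewrite /= !rmorphM -[m]addn0; apply: level_spanM; last by move=> S.
  rewrite -[m]add0n; apply: level_spanM; first by move=> S.
  case: (Gg j) => S /dependentE [s /setIP [sS _] ms] ->.
  have [c c0 ->] := boundary_prod K sS.
  rewrite /= linearZ /= rmorph_prod; apply: level_spanZ.
  apply: (level_span_leq (j := (\sum_(i <- enum (S :\ s)) (rt i == rt s))%N)).
    apply: leq_trans ms _; rewrite -sum1_card big_enum /= big_mkcond [leqRHS]big_mkcond.
    by apply: leq_sum => i _; rewrite inE; case: (i \in S :\ s); case: eqP.
  apply: level_span_prod => i; case: eqP => [Ei|_]; last by move=> T.
  (* The common root cancels, so only moved variables remain and the factor has level at least 1. *)
  rewrite raddfB /= !ext_map_gen !expand_mxE Ei opprD addrACA subrr addr0.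
  rewrite -scaleNr; apply: level_spanD.
    case: (boolP (i \in moved)) => im; rewrite ?scale1r ?scale0r; first exact: inV.
    by move=> T; rewrite ffunE eqxx.
  case: (boolP (s \in moved)) => im; first by apply: level_spanZ; apply: inV.
  by rewrite oppr0 scale0r => T; rewrite ffunE eqxx.
rewrite -[x]contractK; move: (ext_map expand_mx x) Vx => w Vw.
rewrite [w]ext_sumE raddf_sum; apply: ideal_gen_sum => T _.
rewrite [X in ideal_gen _ X]linearZ /=.
have [->|/Vw mT] := eqVneq (w T) 0; first by rewrite scale0r; apply: ideal_gen0.
(* A divisor with exactly [m] moved indices yields the generator; the other indices of [T] go into
   the coefficient. *)
have [T' T'sub cT'] := exists_subset mT.
have T'T : T' \subset T by apply/subsetP => i /(subsetP T'sub); rewrite inE => /andP[].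
have T'm : T' \subset moved.
  by apply/subsetP => i /(subsetP T'sub); rewrite inE mem_enum => /andP[].
have [s sG [rs rT]] := common_root T'm cT'.
have sT' : s \notin T' by apply: contraL (T'm) => sT'; apply/subsetPn; exists s;
  rewrite // inE rs eqxx.
have [c c0 bd] := @boundary_prod K n s (s |: T') (setU11 _ _).
have Em : ext_map contract_mx (extb K T') = c^-1 *: boundary K (s |: T').
  rewrite bd scalerA mulVf // scale1r setU1K // ext_map_extb.
  rewrite big_seq [RHS]big_seq; apply: eq_bigr => i; rewrite mem_enum => iT.
  by rewrite contract_mxE (subsetP T'm) // scale1r rT.
have -> : extb K T = (-1) ^+ shuffle_inv (T :\: T') T' *: (extb K (T :\: T') * extb K T').
  rewrite extb_mul -setI_eq0 setIDAC setDIl setDv setI0 eqxx setDUK //.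
  by rewrite scalerA -expr2 sqrr_sign scale1r.
rewrite linearZ /= rmorphM /= Em -scalerAr !scalerA scalerAl -[_ * _]mulr1.
apply: ideal_gen_mul; exists (s |: T') => //; apply/dependentE.
exists s; first by rewrite in_setI setU11.
rewrite setU1K // -cT'; apply: subset_leq_card; apply/subsetP => i iT.
by rewrite inE iT rT // rs eqxx.
Qed.

Lemma orlik_solomon_betti (i : nat) : betti_number (@orlik_solomon K n M) i
  ('C(#|moved| + i, m + i) * 'C((m + i).-1, i))%N.
Proof.
rewrite cardE; pose r j := ('C(size (enum moved) + j, m + j) * 'C((m + j).-1, j))%N.
apply: (@linear_res_betti K n m _ r).
apply: eq_linear_res (linear_res_map expandK contractK
  (@ext_map_homogeneous _ _ _) (power_linear_res K m (enum_uniq moved))) => // x.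
by apply: iff_sym; apply: orlik_solomon_power.
Qed.

End Retraction.

Close Scope ring_scope.

(** * Matroids *)

Section DirectSums.
Variable n : nat.
Implicit Types A B S : {set 'I_n}.

Lemma direct_sumP A B (I1 I2 : {set {set 'I_n}}) S : [disjoint A & B] ->
  {in I1, forall S1, S1 \subset A} -> {in I2, forall S2, S2 \subset B} ->
  reflect [/\ S \subset A :|: B, S :&: A \in I1 & S :&: B \in I2]
    (S \in direct_sum I1 I2).
Proof.
move=> dAB sA sB; apply: (iffP imset2P) => [[S1 S2 I1S I2S ->]|[SAB SA SB]].
  have S1A := sA _ I1S; have S2B := sB _ I2S.
  have AB0 : A :&: B = set0 by apply/eqP; rewrite setI_eq0.
  have S1B : S1 :&: B = set0.
    by apply/eqP; rewrite -subset0 -AB0 setSI.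
  have S2A : S2 :&: A = set0.
    by apply/eqP; rewrite -subset0 -AB0 [A :&: B]setIC setSI.
  rewrite !setIUl S1B S2A (setIidPl S1A) (setIidPl S2B) setU0 set0U; split=> //.
  exact: setUSS.
by exists (S :&: A) (S :&: B); rewrite // -setIUr (setIidPl SAB).
Qed.

Lemma uniform_sub a A : {in uniform a A, forall S, S \subset A}.
Proof. by move=> S; rewrite inE => /andP[]. Qed.

Lemma uniform_full A : uniform #|A| A = powerset A.
Proof.
apply/setP => S; rewrite !inE; apply: andb_idr => SA.
exact: subset_leq_card.
Qed.

Lemma big_uniform1P k (A : 'I_k -> {set 'I_n}) (s : seq 'I_k) S :
  (forall i j, i != j -> [disjoint A i & A j]) -> uniq s ->
  reflect (S \subset \bigcup_(i <- s) A i /\ {in s, forall i, #|S :&: A i| <= 1})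
    (S \in \big[@direct_sum n/[set set0]]_(i <- s) uniform 1 (A i)).
Proof.
move=> dA; elim: s S => [|i s IH] S /=.
  rewrite !big_nil inE subset0 => _; apply: (iffP idP) => [S0|[]//].
  by split=> // i.
case/andP => i_s us; rewrite !big_cons.
have dis : [disjoint A i & \bigcup_(j <- s) A j].
  rewrite bigcup_seq; apply/bigcup_disjointP => j js; apply: dA.
  by apply: contraNneq i_s => ->.
apply: (iffP (direct_sumP _ dis (@uniform_sub _ _) _)).
- by move=> T /(IH _ us) [].
- case=> Ssub SAi /(IH _ us) [_ Ss]; split=> // j; rewrite inE => /orP[/eqP ->|js].
    by move: SAi; rewrite inE => /andP[].
  have := Ss j js; rewrite -setIA [_ :&: A j](setIidPr _) //.
  by rewrite bigcup_seq; apply: bigcup_sup.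
case=> Ssub Ss; split=> //.
  by rewrite inE subsetIr Ss ?mem_head.
apply/(IH _ us); split; first exact: subsetIr.
move=> j js; apply: leq_trans (subset_leq_card _) (Ss j _); last by rewrite inE js orbT.
by apply/setSI/subsetIl.
Qed.

End DirectSums.

Section TwoFamilies.
Variables (K : fieldType) (n : nat) (M : matroid n).

(** All of [A] is retracted to one root and the coloops are fixed, so [#|A| - 1] indices move; hence
    the predecessor in the first binomial. *)
Lemma uniform_plus_coloops_betti (m : nat) (A B : {set 'I_n}) (i : nat) :
  [disjoint A & B] -> A :|: B = setT -> (0 < m) || (0 < #|A|) ->
  indep M = direct_sum (uniform m A) (uniform #|B| B) ->
  betti_number (@orlik_solomon K n M) i
    ('C((#|A| + i).-1, m + i) * 'C((m + i).-1, i)).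
Proof.
move=> dAB AB mA indM.
have depP S : (S \notin indep M) = (m < #|S :&: A|).
  rewrite indM ltnNge uniform_full; congr (~~ _).
  have subB : {in powerset B, forall T : {set 'I_n}, T \subset B} by move=> T; rewrite inE.
  apply/(direct_sumP S dAB (@uniform_sub _ m A) subB)/idP => [[_]|SA].
    by rewrite inE => /andP[].
  by rewrite AB subsetT !inE !subsetIr SA.
(* Without elements in [A] there is no root to choose; then [m > 0], no set is dependent, and the
   identity retraction gives Betti number 0. *)
have [A0|/set0Pn [a0 a0A]] := eqVneq A set0.
  have m0 : 0 < m by move: mA; rewrite A0 cards0 orbF.
  have moved0 : moved (@id 'I_n) = set0 by apply/setP => j; rewrite !inE eqxx.
  have lt_i : 0 + i < m + i by rewrite ltn_add2r.
  rewrite A0 cards0 [in 'C((0 + i).-1, _)]bin_small ?mul0n; last first.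
    exact: leq_ltn_trans (leq_pred _) lt_i.
  have := @orlik_solomon_betti K n id _ M m set0 _ _ i.
  rewrite moved0 cards0 (bin_small lt_i) mul0n; apply=> //.
    move=> S; rewrite depP A0 setI0 cards0 ltn0.
    by split=> // -[s]; rewrite inE.
  by move=> T; rewrite subset0 => /eqP -> /eqP; rewrite cards0 eq_sym (gtn_eqF m0).
pose rt i := if i \in A then a0 else i.
have rtA j : (rt j == a0) = (j \in A).
  rewrite /rt; have [//|nA] := boolP (j \in A); first by rewrite eqxx.
  by apply: contraNF nA => /eqP ->.
have movedE : moved rt = A :\ a0.
  apply/setP => j; rewrite !inE /rt eq_sym.
  by have [jA|nA] := boolP (j \in A); rewrite ?eqxx ?andbT ?andbF.
have cA : #|A| = #|moved rt|.+1 by rewrite movedE (cardsD1 a0 A) a0A.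
rewrite cA addSn /=; apply: (@orlik_solomon_betti K n rt _ M m A).
- by move=> j; rewrite /rt; have [jA|/negPf nA] := boolP (j \in A); rewrite ?a0A ?nA.
- move=> S; rewrite depP.
  have cS s : s \in S :&: A -> #|S :&: A| = #|[set j in S :\ s | rt j == rt s]|.+1.
    case/setIP => sS sA; rewrite (cardsD1 s) inE sS sA add1n; congr _.+1.
    apply: eq_card => j; rewrite !inE {2}/rt sA rtA.
    by rewrite andbA.
  split=> [mS|[s sSA]]; last by rewrite (cS s sSA) ltnS.
  have /set0Pn [s sSA] : S :&: A != set0 by rewrite -card_gt0 (leq_trans _ mS).
  by exists s; rewrite // -ltnS -cS.
- move=> T TA _; exists a0 => //; split; first by rewrite /rt a0A.
  move=> j /(subsetP TA); rewrite movedE => /setD1P [_ jA]; apply/eqP.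
  by rewrite rtA.
Qed.

(** Each class [A j] is retracted to its own root, with [m = 1]; the second binomial is then
    ['C(i, i) = 1]. *)
Lemma rank1_sum_plus_coloops_betti (k : nat) (A : 'I_k -> {set 'I_n})
    (B : {set 'I_n}) (i : nat) :
  (forall j, A j != set0) -> (forall j j', j != j' -> [disjoint A j & A j']) ->
  (forall j, [disjoint A j & B]) -> (\bigcup_(j < k) A j) :|: B = setT ->
  indep M = direct_sum (\big[@direct_sum n/[set set0]]_(j < k) uniform 1 (A j))
                       (uniform #|B| B) ->
  betti_number (@orlik_solomon K n M) i 'C(n - #|B| - k + i, i.+1).
Proof.
move=> A0 dA dAB AB indM.
have disAB : [disjoint \bigcup_(j < k) A j & B].
  rewrite disjoint_sym; apply/bigcup_disjointP => j _; by rewrite disjoint_sym.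
have depP S : (S \notin indep M) = [exists j, 1 < #|S :&: A j|].
  rewrite indM uniform_full -[RHS]negbK; congr (~~ _); rewrite negb_exists.
  have subB : {in powerset B, forall T : {set 'I_n}, T \subset B} by move=> T; rewrite inE.
  have subA : {in \big[@direct_sum n/[set set0]]_(j < k) uniform 1 (A j),
      forall T : {set 'I_n}, T \subset \bigcup_(j < k) A j}.
    by move=> T /(big_uniform1P _ dA (index_enum_uniq _)) [].
  apply/(direct_sumP S disAB subA subB)/forallP => [[_ SA _] j|SA].
    rewrite -leqNgt; have [_ /(_ j (mem_index_enum j))] :=
      big_uniform1P _ dA (index_enum_uniq _) SA.
    by rewrite -setIA [_ :&: A j](setIidPr _) //; apply: bigcup_sup.
  split; [by rewrite AB subsetT | | by rewrite inE subsetIr].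
  apply/(big_uniform1P _ dA (index_enum_uniq _)); split; first exact: subsetIr.
  move=> j _; rewrite -setIA [_ :&: A j](setIidPr _) //; first by rewrite leqNgt.
  exact: bigcup_sup.
have [root rootA] : exists root : 'I_k -> 'I_n, forall j, root j \in A j.
  by apply: (@fin_all_exists _ _ (fun j x => x \in A j)) => j; apply/set0Pn.
have Auniq j j' x : x \in A j -> x \in A j' -> j = j'.
  move=> xj xj'; apply/eqP; apply: contraTT isT => /dA /disjointFr /(_ xj).
  by rewrite xj'.
pose rt x := if [pick j | x \in A j] is Some j then root j else x.
have rtA j x : x \in A j -> rt x = root j.
  move=> xj; rewrite /rt; case: pickP => [j' xj'|/(_ j)]; last by rewrite xj.
  by rewrite (Auniq _ _ _ xj xj').
have rtB x : (forall j, x \notin A j) -> rt x = x.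
  by move=> xA; rewrite /rt; case: pickP => // j; rewrite (negPf (xA j)).
have inA x : (exists j, x \in A j) \/ (forall j, x \notin A j).
  case: (pickP (fun j => x \in A j)) => [j xj|xA]; first by left; exists j.
  by right=> j; rewrite xA.
have rt_idem x : rt (rt x) = rt x.
  by case: (inA x) => [[j xj]|xA]; rewrite ?(rtB _ xA) // (rtA _ _ xj) (rtA _ _ (rootA j)).
(* The fixed points are the coloops and the [k] distinct roots, which counts the moved indices. *)
have movedC : ~: moved rt = B :|: root @: 'I_k.
  apply/setP => x; rewrite !inE negbK; apply/eqP/orP => [rx|].
    case: (inA x) => [[j xj]|xA]; [right | left].
      by rewrite -rx (rtA _ _ xj); apply: imset_f.
    have : x \in (\bigcup_(j < k) A j) :|: B by rewrite AB inE.
    by rewrite inE => /orP[/bigcupP [j _]|//]; rewrite (negPf (xA j)).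
  case=> [xB|/imsetP [j _ ->]]; last exact: rtA.
  by apply: rtB => j; rewrite (disjointFl (dAB j) xB).
have root_inj : injective root.
  by move=> j j' E; apply: (Auniq _ _ (root j)); rewrite // E.
have cM : #|moved rt| = n - #|B| - k.
  have := cardsC (moved rt); rewrite movedC cardsU card_imset // !card_ord.
  have -> : B :&: root @: 'I_k = set0.
    apply/setP => x; rewrite !inE; apply/negP => /andP[xB /imsetP [j _ Ex]].
    by move: (rootA j); rewrite -Ex (disjointFl (dAB j) xB).
  by rewrite cards0 subn0 -subnDA => /(congr1 (subn^~ (#|B| + k))) /=; rewrite addnK.
have := @orlik_solomon_betti K n rt rt_idem M 1 setT _ _ i.
rewrite cM add1n binn muln1; apply.
- move=> S; rewrite depP; split=> [/existsP [j]|[s /setIP [sS _]]].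
    case/card_gt1P => x [y] [/setIP [xS xj] /setIP [yS yj] xy].
    exists x; first by rewrite inE xS inE.
    rewrite card_gt0; apply/set0Pn; exists y.
    by rewrite !inE eq_sym xy yS (rtA _ _ xj) (rtA _ _ yj) eqxx.
  rewrite card_gt0 => /set0Pn [y]; rewrite !inE -andbA => /and3P[ys yS /eqP Ey].
  (* Distinct classes have distinct roots, and an index outside all classes is its own image, so two
     distinct indices with equal images share a class. *)
  have [j sj yj] : exists2 j, s \in A j & y \in A j.
    case: (inA s) (inA y) => [[j sj]|sA] [[j' yj]|yA].
    - exists j => //; suff -> : j = j' by [].
      by apply: root_inj; rewrite -(rtA _ _ sj) -(rtA _ _ yj).
    - by move: (yA j); rewrite -(rtB _ yA) Ey (rtA _ _ sj) rootA.
    - by move: (sA j'); rewrite -(rtB _ sA) -Ey (rtA _ _ yj) rootA.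
    - by move: Ey ys; rewrite (rtB _ yA) (rtB _ sA) => ->; rewrite eqxx.
  apply/existsP; exists j; apply/card_gt1P; exists s, y.
  by rewrite !inE sS yS sj yj eq_sym ys.
- move=> T _ /eqP/cards1P [t ->]; exists (rt t); first by rewrite inE.
  by split=> // x; rewrite inE => /eqP ->.
Qed.

End TwoFamilies.

Theorem theorem6p12 (K : fieldType) (n : nat) (M : matroid n) :
  (forall (m f : nat) (A B : {set 'I_n}),
      [disjoint A & B] -> A :|: B = [set: 'I_n] ->
      #|A| = (n - f)%N -> #|B| = f ->
      (0 < m)%N || (f < n)%N ->
      indep M = direct_sum (uniform m A) (uniform f B) ->
      forall i : nat,
        betti_number (@orlik_solomon K n M) i
          ('C((n - f + i).-1, m + i) * 'C((m + i).-1, i))%N)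
  /\
  (forall (k f : nat) (n_ : 'I_k -> nat) (A : 'I_k -> {set 'I_n})
      (B : {set 'I_n}),
      (forall i, 0 < n_ i)%N ->
      n = (f + \sum_(i < k) n_ i)%N ->
      (forall i j, i != j -> [disjoint A i & A j]) ->
      (forall i, [disjoint A i & B]) ->
      (\bigcup_(i < k) A i) :|: B = [set: 'I_n] ->
      (forall i, #|A i| = n_ i) -> #|B| = f ->
      indep M =
        direct_sum (\big[@direct_sum n/[set set0]]_(i < k) uniform 1 (A i))
                   (uniform f B) ->
      forall i : nat,
        betti_number (@orlik_solomon K n M) i 'C(n - f - k + i, i.+1)).
Proof.
split.
- move=> m f A B dAB AB cA cB mf indM i.
  have := @uniform_plus_coloops_betti K n M m A B i dAB AB.
  rewrite cA cB subn_gt0; exact.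
- move=> k f n_ A B n_gt0 nE dA dAB AB cA cB indM i.
  rewrite -cB; apply: rank1_sum_plus_coloops_betti dA dAB AB _.
    by move=> j; rewrite -card_gt0 cA.
  by rewrite cB.
Qed.
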